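(* The Radon monad $\mathsf R$ on the category $\mathbf{KH}$ of compact Hausdorff spaces and continuous maps is a linear exponential monad with respect to the join monoidal structure $(\star,0)$ on $\mathbf{KH}$; that is, $\mathsf R$ admits a symmetric opmonoidal structure with respect to $(\star,0)$ for which the lifted symmetric monoidal structure on the category of $\mathsf R$-algebras is given by finite coproducts.
   Context: A Radon probability measure on a compact Hausdorff space $X$ is a probability measure $\omega$ on the Borel $\sigma$-algebra of $X$ such that $\omega(M)=\sup\{\omega(K):K\subseteq M,\ K\text{ compact}\}$ for all Borel $M$. $\mathcal R(X)$ is the set of these with the weak topology: the coarsest making $\omega\mapsto\int f\,\mathrm d\omega$ continuous for each continuous $f\colon X\to\mathbb R$. The Radon monad $\mathsf R=(\mathcal R,\eta,\mu)$ on $\mathbf{KH}$ acts on maps by pushforward of measures; its unit sends points to Dirac measures; its multiplication is given by integration, $\mu_X(\Omega)(M)=\int_{\tau\in\mathcal R(X)}\tau(M)\,\mathrm d\Omega(\tau)$. The join monoidal structure on $\mathbf{KH}$ has unit the empty space $0$; the tensor $X\star Y$ is the topological join, realised as the set $X+\bigl((0,1)\times X\times Y\bigr)+Y$ with basis of open sets given by the sets $U+\bigl((a,1)\times U\times Y\bigr)+\emptyset$, $\ \emptyset+\bigl((a,b)\times U\times V\bigr)+\emptyset$, $\ \emptyset+\bigl((0,b)\times X\times V\bigr)+V$, for rationals $0<a<b<1$ and $U\subseteq X$, $V\subseteq Y$ open. (For $X,Y$ non-empty this is the quotient of $[0,1]\times X\times Y$ by the smallest equivalence relation with $(0,x,y)\sim(0,x',y)$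 and $(1,x,y)\sim(1,x,y')$.) On maps, $f\star g=f+\bigl((0,1)\times f\times g\bigr)+g$. The constraints have the following underlying functions. The unit constraints are the evident ones. Writing $r^*=1-r$, the associativity constraint $(X\star Y)\star Z\to X\star(Y\star Z)$ sends $(r,(s,x,y),z)$ to $\bigl(rs,x,(\tfrac{rs^*}{(rs)^*},y,z)\bigr)$ and is the evident identity on the remaining summands; the symmetry sends $(r,x,y)$ to $(r^*,y,x)$ and is the evident identity on the summands $X$ and $Y$. A symmetric opmonoidal structure on a monad $\mathsf T=(T,\eta,\mu)$ on a symmetric monoidal category $(\mathcal C,\otimes,I)$ consists of a map $\upsilon_I\colon TI\to I$ and natural maps $\upsilon_{XY}\colon T(X\otimes Y)\to TX\otimes TY$ making $T$ a symmetric opmonoidal (colax monoidal) functor and $\eta,\mu$ opmonoidal transformations. It lifts the symmetric monoidal structure of $\mathcal C$ to the category $\mathcal C^{\mathsf T}$ of Eilenberg--Moore algebras: $(X,x)\otimes(Y,y)=(X\otimes Y,(x\otimes y)\circ\upsilon_{XY})$, with unit $(I,\upsilon_I)$ and constraints those of $\mathcal C$. (Such structures correspond bijectively to symmetric monoidal structures on $\mathcal C^{\mathsf T}$ for which the forgetful functor is strict symmetric monoidal.) A linear exponential monad is a symmetric opmonoidal monad for which $(I,\upsilon_I)$ is initial in $\mathcal C^{\mathsf T}$ and, for all algebras $(X,x),(Y,y)$, the cospan $(X,x)\cong(X,x)\otimes(I,\upsilon_I)\xrightarrow{1\otimes !}(X,x)\otimes(Y,y)\xleftarrow{!\otimes 1}(I,\upsilon_I)\otimes(Y,y)\cong(Y,y)$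 is a coproduct in $\mathcal C^{\mathsf T}$, where $!$ denotes the unique maps out of the initial algebra. *)

(* Defs.v *)
From HB Require Import structures.
From mathcomp Require Import all_boot all_order all_algebra.
From mathcomp Require Import all_classical all_reals all_analysis.
From mathcomp Require Import ring lra.

Set Implicit Arguments.
Unset Strict Implicit.
Unset Printing Implicit Defensive.

Import Order.TTheory GRing.Theory Num.Theory.
Import numFieldNormedType.Exports.

Local Open Scope classical_set_scope.
Local Open Scope ring_scope.

Record category := Category {
  ob :> Type;
  hom : ob -> ob -> Type;
  idm : forall A, hom A A;
  ccomp : forall A B C, hom B C -> hom A B -> hom A C;
  compA : forall A B C D (h : hom C D) (g : hom B C) (f : hom A B),
    ccomp h (ccomp g f) = ccomp (ccomp h g) f;
  comp1m : forall A B (f : hom A B), ccomp (idm B) f = f;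
  compm1 : forall A B (f : hom A B), ccomp f (idm A) = f }.

Arguments hom {c} A B.
Arguments idm {c} A.
Arguments ccomp {c A B C} g f.

Declare Scope cat_scope.
Delimit Scope cat_scope with cat.
Notation "g ∘ f" := (ccomp g f) (at level 40, left associativity) : cat_scope.
Local Open Scope cat_scope.

Definition is_initial (C : category) (I : C) : Prop :=
  forall A : C, exists u : hom I A, forall v : hom I A, v = u.

Definition is_coproduct (C : category) (A B P : C)
    (i : hom A P) (j : hom B P) : Prop :=
  forall (Z : C) (f : hom A Z) (g : hom B Z),
    exists h : hom P Z,
      (h ∘ i = f /\ h ∘ j = g) /\
      forall k : hom P Z, k ∘ i = f /\ k ∘ j = g -> k = h.

(* Functors, monads and monoidal structures are indexed by their action on
   objects, so that prescribing that action involves no equality of objects. *)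

Record functor (C D : category) (F : C -> D) := Functor {
  fmap : forall A B, hom A B -> hom (F A) (F B);
  fmap1 : forall A, fmap (idm A) = idm (F A);
  fmapM : forall A B C (g : hom B C) (f : hom A B),
    fmap (g ∘ f) = fmap g ∘ fmap f }.

Arguments fmap {C D F} _ {A B} _.

Record monad (C : category) (T : C -> C) := Monad {
  mfun :> functor T;
  eta : forall A, hom A (T A);
  mu : forall A, hom (T (T A)) (T A);
  eta_nat : forall A B (f : hom A B), fmap mfun f ∘ eta A = eta B ∘ f;
  mu_nat : forall A B (f : hom A B),
    fmap mfun f ∘ mu A = mu B ∘ fmap mfun (fmap mfun f);
  mu_etal : forall A, mu A ∘ eta (T A) = idm (T A);
  mu_etar : forall A, mu A ∘ fmap mfun (eta A) = idm (T A);
  mu_mu : forall A, mu A ∘ fmap mfun (mu A) = mu A ∘ mu (T A) }.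

Arguments eta {C T} m A.
Arguments mu {C T} m A.

Record sym_monoidal (C : category) (tens : C -> C -> C) (I : C) :=
  SymMonoidal {
  tmap : forall A A' B B',
    hom A A' -> hom B B' -> hom (tens A B) (tens A' B');
  assoc : forall A B D, hom (tens (tens A B) D) (tens A (tens B D));
  associ : forall A B D, hom (tens A (tens B D)) (tens (tens A B) D);
  lunit : forall A, hom (tens I A) A;
  luniti : forall A, hom A (tens I A);
  runit : forall A, hom (tens A I) A;
  runiti : forall A, hom A (tens A I);
  symm : forall A B, hom (tens A B) (tens B A);
  tmap1 : forall A B, tmap (idm A) (idm B) = idm (tens A B);
  tmapM : forall A A' A'' B B' B'' (f' : hom A' A'') (f : hom A A')
      (g' : hom B' B'') (g : hom B B'),
    tmap (f' ∘ f) (g' ∘ g) = tmap f' g' ∘ tmap f g;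
  assocK : forall A B D, associ A B D ∘ assoc A B D = idm _;
  associK : forall A B D, assoc A B D ∘ associ A B D = idm _;
  lunitK : forall A, luniti A ∘ lunit A = idm _;
  lunitiK : forall A, lunit A ∘ luniti A = idm _;
  runitK : forall A, runiti A ∘ runit A = idm _;
  runitiK : forall A, runit A ∘ runiti A = idm _;
  symmK : forall A B, symm B A ∘ symm A B = idm _;
  assoc_nat : forall A A' B B' D D'
      (f : hom A A') (g : hom B B') (h : hom D D'),
    assoc A' B' D' ∘ tmap (tmap f g) h = tmap f (tmap g h) ∘ assoc A B D;
  lunit_nat : forall A A' (f : hom A A'),
    lunit A' ∘ tmap (idm I) f = f ∘ lunit A;
  runit_nat : forall A A' (f : hom A A'),
    runit A' ∘ tmap f (idm I) = f ∘ runit A;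
  symm_nat : forall A A' B B' (f : hom A A') (g : hom B B'),
    symm A' B' ∘ tmap f g = tmap g f ∘ symm A B;
  pentagon : forall A B D E,
    assoc A B (tens D E) ∘ assoc (tens A B) D E =
    tmap (idm A) (assoc B D E) ∘ assoc A (tens B D) E
      ∘ tmap (assoc A B D) (idm E);
  triangle : forall A B,
    tmap (idm A) (lunit B) ∘ assoc A I B = tmap (runit A) (idm B);
  hexagon : forall A B D,
    assoc B D A ∘ symm A (tens B D) ∘ assoc A B D =
    tmap (idm B) (symm A D) ∘ assoc B A D ∘ tmap (symm A B) (idm D) }.

Arguments tmap {C tens I} s {A A' B B'} f g.
Arguments assoc {C tens I} s A B D.
Arguments associ {C tens I} s A B D.
Arguments lunit {C tens I} s A.
Arguments luniti {C tens I} s A.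
Arguments runit {C tens I} s A.
Arguments runiti {C tens I} s A.
Arguments symm {C tens I} s A B.

Record sym_opmonoidal (C : category) (tens : C -> C -> C) (I : C)
    (S : sym_monoidal tens I) (T : C -> C) (M : monad T) := SymOpmonoidal {
  ups0 : hom (T I) I;
  ups : forall A B, hom (T (tens A B)) (tens (T A) (T B));
  ups_nat : forall A A' B B' (f : hom A A') (g : hom B B'),
    tmap S (fmap M f) (fmap M g) ∘ ups A B = ups A' B' ∘ fmap M (tmap S f g);
  ups_assoc : forall A B D,
    assoc S (T A) (T B) (T D) ∘ tmap S (ups A B) (idm (T D))
      ∘ ups (tens A B) D =
    tmap S (idm (T A)) (ups B D) ∘ ups A (tens B D) ∘ fmap M (assoc S A B D);
  ups_lunit : forall A,
    lunit S (T A) ∘ tmap S ups0 (idm (T A)) ∘ ups I A = fmap M (lunit S A);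
  ups_runit : forall A,
    runit S (T A) ∘ tmap S (idm (T A)) ups0 ∘ ups A I = fmap M (runit S A);
  ups_symm : forall A B,
    symm S (T A) (T B) ∘ ups A B = ups B A ∘ fmap M (symm S A B);
  ups_eta : forall A B,
    ups A B ∘ eta M (tens A B) = tmap S (eta M A) (eta M B);
  ups0_eta : ups0 ∘ eta M I = idm I;
  ups_mu : forall A B,
    ups A B ∘ mu M (tens A B) =
    tmap S (mu M A) (mu M B) ∘ ups (T A) (T B) ∘ fmap M (ups A B);
  ups0_mu : ups0 ∘ mu M I = ups0 ∘ fmap M ups0 }.

Record algebra (C : category) (T : C -> C) (M : monad T) := Algebra {
  carrier : C;
  act : hom (T carrier) carrier;
  act_eta : act ∘ eta M carrier = idm carrier;
  act_mu : act ∘ mu M carrier = act ∘ fmap M act }.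

Section EilenbergMoore.
Variables (C : category) (T : C -> C) (M : monad T).

Definition alg_hom (X Y : algebra M) : Type :=
  {f : hom (carrier X) (carrier Y) | f ∘ act X = act Y ∘ fmap M f}.

Lemma alg_hom_eq (X Y : algebra M) (f g : alg_hom X Y) :
  sval f = sval g -> f = g.
Proof.
case: f g => [f fP] [g gP] /= fg; subst g.
by congr exist; exact: Prop_irrelevance.
Qed.

Lemma alg_id_subproof (X : algebra M) :
  idm (carrier X) ∘ act X = act X ∘ fmap M (idm (carrier X)).
Proof. by rewrite fmap1 comp1m compm1. Qed.

Definition alg_id (X : algebra M) : alg_hom X X := exist _ _ (alg_id_subproof X).

Lemma alg_comp_subproof (X Y Z : algebra M)
    (g : alg_hom Y Z) (f : alg_hom X Y) :
  (sval g ∘ sval f) ∘ act X = act Z ∘ fmap M (sval g ∘ sval f).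
Proof.
by rewrite -compA (svalP f) compA (svalP g) fmapM compA.
Qed.

Definition alg_comp (X Y Z : algebra M) (g : alg_hom Y Z) (f : alg_hom X Y) :
  alg_hom X Z := exist _ _ (alg_comp_subproof g f).

Definition EM : category.
Proof.
refine (@Category (algebra M) alg_hom alg_id alg_comp _ _ _).
- by move=> X Y Z W h g f; apply: alg_hom_eq; rewrite /= compA.
- by move=> X Y f; apply: alg_hom_eq; rewrite /= comp1m.
- by move=> X Y f; apply: alg_hom_eq; rewrite /= compm1.
Defined.

End EilenbergMoore.

Section Lifting.
Variables (C : category) (tens : C -> C -> C) (I : C) (S : sym_monoidal tens I).
Variables (T : C -> C) (M : monad T) (U : sym_opmonoidal S M).

Lemma tens_alg_eta (X Y : EM M) :
  (tmap S (act X) (act Y) ∘ ups U (carrier X) (carrier Y))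
    ∘ eta M (tens (carrier X) (carrier Y)) = idm _.
Proof. by rewrite -compA ups_eta -tmapM !act_eta tmap1. Qed.

Lemma tens_alg_mu (X Y : EM M) :
  let a := tmap S (act X) (act Y) ∘ ups U (carrier X) (carrier Y) in
  a ∘ mu M (tens (carrier X) (carrier Y)) = a ∘ fmap M a.
Proof.
rewrite /= -compA ups_mu !compA -tmapM !act_mu tmapM fmapM compA.
congr (_ ∘ _); rewrite -!compA; congr (_ ∘ _); exact: ups_nat.
Qed.

Definition tens_alg (X Y : EM M) : EM M :=
  Algebra (tens_alg_eta X Y) (tens_alg_mu X Y).

Definition unit_alg : EM M := Algebra (ups0_eta U) (ups0_mu U).

Lemma tmap_alg_subproof (X X' Y Y' : EM M) (f : hom X X') (g : hom Y Y') :
  tmap S (sval f) (sval g) ∘ act (tens_alg X Y) =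
  act (tens_alg X' Y') ∘ fmap M (tmap S (sval f) (sval g)).
Proof.
rewrite /= compA -tmapM (svalP f) (svalP g) tmapM -!compA; congr (_ ∘ _).
exact: ups_nat.
Qed.

Definition tmap_alg (X X' Y Y' : EM M) (f : hom X X') (g : hom Y Y') :
    @hom (EM M) (tens_alg X Y) (tens_alg X' Y') :=
  exist _ _ (tmap_alg_subproof f g).

Lemma assoc_alg_subproof (X Y Z : EM M) :
  assoc S (carrier X) (carrier Y) (carrier Z)
    ∘ act (tens_alg (tens_alg X Y) Z) =
  act (tens_alg X (tens_alg Y Z))
    ∘ fmap M (assoc S (carrier X) (carrier Y) (carrier Z)).
Proof.
rewrite /= -[act Z]compm1 tmapM !compA assoc_nat compm1.
rewrite -[act X in RHS]compm1 tmapM -!compA; congr (_ ∘ _).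
by rewrite !compA ups_assoc.
Qed.

Lemma lunit_alg_subproof (X : EM M) :
  lunit S (carrier X) ∘ act (tens_alg unit_alg X) =
  act X ∘ fmap M (lunit S (carrier X)).
Proof.
rewrite /= -[ups0 U]comp1m -[act X in LHS]compm1 tmapM !compA lunit_nat.
by rewrite -!compA; congr (_ ∘ _); rewrite compA ups_lunit.
Qed.

Lemma runit_alg_subproof (X : EM M) :
  runit S (carrier X) ∘ act (tens_alg X unit_alg) =
  act X ∘ fmap M (runit S (carrier X)).
Proof.
rewrite /= -[ups0 U]comp1m -[act X in LHS]compm1 tmapM !compA runit_nat.
by rewrite -!compA; congr (_ ∘ _); rewrite compA ups_runit.
Qed.

Lemma symm_alg_subproof (X Y : EM M) :
  symm S (carrier X) (carrier Y) ∘ act (tens_alg X Y) =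
  act (tens_alg Y X) ∘ fmap M (symm S (carrier X) (carrier Y)).
Proof. by rewrite /= compA symm_nat -!compA ups_symm. Qed.

Lemma alg_inv_subproof (X Y : EM M) (f : hom (carrier X) (carrier Y))
    (g : hom (carrier Y) (carrier X)) :
  g ∘ f = idm _ -> f ∘ g = idm _ ->
  f ∘ act X = act Y ∘ fmap M f -> g ∘ act Y = act X ∘ fmap M g.
Proof.
move=> gf fg fP.
transitivity (g ∘ (act Y ∘ fmap M f ∘ fmap M g)).
  by rewrite -compA -fmapM fg fmap1 compm1.
by rewrite -fP !compA gf comp1m.
Qed.

Let T2 := tens_alg.
Let T0 := unit_alg.

Definition assoc_alg (X Y Z : EM M) :
    @hom (EM M) (T2 (T2 X Y) Z) (T2 X (T2 Y Z)) :=
  exist _ _ (assoc_alg_subproof X Y Z).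

Definition associ_alg (X Y Z : EM M) :
    @hom (EM M) (T2 X (T2 Y Z)) (T2 (T2 X Y) Z) :=
  exist _ _ (alg_inv_subproof (X := T2 (T2 X Y) Z) (Y := T2 X (T2 Y Z))
    (assocK S _ _ _) (associK S _ _ _) (assoc_alg_subproof X Y Z)).

Definition lunit_alg (X : EM M) : @hom (EM M) (T2 T0 X) X :=
  exist _ _ (lunit_alg_subproof X).

Definition luniti_alg (X : EM M) : @hom (EM M) X (T2 T0 X) :=
  exist _ _ (alg_inv_subproof (X := T2 T0 X) (Y := X)
    (lunitK S _) (lunitiK S _) (lunit_alg_subproof X)).

Definition runit_alg (X : EM M) : @hom (EM M) (T2 X T0) X :=
  exist _ _ (runit_alg_subproof X).

Definition runiti_alg (X : EM M) : @hom (EM M) X (T2 X T0) :=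
  exist _ _ (alg_inv_subproof (X := T2 X T0) (Y := X)
    (runitK S _) (runitiK S _) (runit_alg_subproof X)).

Definition symm_alg (X Y : EM M) : @hom (EM M) (T2 X Y) (T2 Y X) :=
  exist _ _ (symm_alg_subproof X Y).

Definition lifted : @sym_monoidal (EM M) tens_alg unit_alg.
Proof.
refine (@SymMonoidal (EM M) tens_alg unit_alg tmap_alg assoc_alg associ_alg
  lunit_alg luniti_alg runit_alg runiti_alg symm_alg
  _ _ _ _ _ _ _ _ _ _ _ _ _ _ _ _); intros; apply: alg_hom_eq => /=.
- exact: tmap1.
- exact: tmapM.
- exact: assocK.
- exact: associK.
- exact: lunitK.
- exact: lunitiK.
- exact: runitK.
- exact: runitiK.
- exact: symmK.
- exact: assoc_nat.
- exact: lunit_nat.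
- exact: runit_nat.
- exact: symm_nat.
- exact: pentagon.
- exact: triangle.
- exact: hexagon.
Defined.

Definition linear_exponential : Prop :=
  is_initial unit_alg /\
  forall (X Y : EM M) (bX : hom unit_alg X) (bY : hom unit_alg Y),
    is_coproduct (tmap lifted (idm X) bY ∘ runiti lifted X)
                 (tmap lifted bX (idm Y) ∘ luniti lifted Y).

End Lifting.

Definition compact_hausdorff (X : topologicalType) : Prop :=
  compact [set: X] /\ hausdorff_space X.

Record KHspace := MkKH {
  KH_space :> topologicalType;
  KH_prop : compact_hausdorff KH_space }.

Definition KH : category.
Proof.
refine (@Category KHspace (fun X Y => continuousType X Y)
  (fun X => [the continuousType X X of idfun])
  (fun X Y Z (g : continuousType Y Z) (f : continuousType X Y) =>
     [the continuousType X Z of g \o f]) _ _ _).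
- by move=> *; apply/continuousEP.
- by move=> *; apply/continuousEP.
- by move=> *; apply/continuousEP.
Defined.

Definition empty_space : topologicalType := discrete_topology void.

Lemma compact_hausdorff_empty : compact_hausdorff empty_space.
Proof. by split=> [F FF /filter_ex[]//|[]]. Qed.

Definition KH0 : KH := MkKH compact_hausdorff_empty.

Section OpenUnitInterval.
Variable R : realType.

Definition oitv := {r : R | 0 < r < 1}.

Lemma oitv_compl_subproof (r : oitv) : 0 < 1 - val r < 1.
Proof. by case: r => r /= /andP[r0 r1]; apply/andP; split; lra. Qed.

Definition oitv_compl (r : oitv) : oitv :=
  exist _ (1 - val r) (oitv_compl_subproof r).

Lemma oitv_mul_subproof (r s : oitv) : 0 < val r * val s < 1.
Proof.
case: r s => [r /= /andP[r0 r1]] [s /= /andP[s0 s1]].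
by apply/andP; split; nra.
Qed.

Definition oitv_mul (r s : oitv) : oitv :=
  exist _ (val r * val s) (oitv_mul_subproof r s).

Lemma oitv_mul_compl_subproof (r s : oitv) :
  0 < val r * (1 - val s) / (1 - val r * val s) < 1.
Proof.
case: r s => [r /= /andP[r0 r1]] [s /= /andP[s0 s1]].
have d0 : 0 < 1 - r * s by nra.
apply/andP; split; first by apply: divr_gt0 => //; nra.
by rewrite ltr_pdivrMr// mul1r; nra.
Qed.

(* r s^* / (r s)^*, where r^* = 1 - r *)
Definition oitv_mul_compl (r s : oitv) : oitv :=
  exist _ (val r * (1 - val s) / (1 - val r * val s)) (oitv_mul_compl_subproof r s).

End OpenUnitInterval.

(* The set X + (0,1) * X * Y + Y; the coordinate tends to 1 at the X end and to
   0 at the Y end. *)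
Inductive join (R : realType) (X Y : Type) : Type :=
  | jl of X
  | jm of oitv R & X & Y
  | jr of Y.
Arguments jl {R X Y} x.
Arguments jm {R X Y} r x y.
Arguments jr {R X Y} y.

HB.instance Definition _ R X Y := gen_eqMixin (join R X Y).
HB.instance Definition _ R X Y := gen_choiceMixin (join R X Y).

Section JoinTopology.
Variables (R : realType) (X Y : topologicalType).
Implicit Types (a b : rat) (U : set X) (V : set Y).

Definition join_setl a U : set (join R X Y) := fun p =>
  match p with
  | jl x => U x
  | jm r x _ => ratr a < val r /\ U x
  | jr _ => False
  end.

Definition join_setm a b U V : set (join R X Y) := fun p =>
  match p with
  | jm r x y => ratr a < val r < ratr b /\ U x /\ V y
  | _ => False
  end.

Definition join_setr b V : set (join R X Y) := fun p =>
  match p with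
  | jl _ => False
  | jm r _ y => val r < ratr b /\ V y
  | jr y => V y
  end.

Definition join_base : set (set (join R X Y)) := [set W |
  exists a b U V, [/\ 0 < a, a < b, b < 1, open U & open V] /\
    [\/ W = join_setl a U, W = join_setm a b U V | W = join_setr b V]].

Lemma join_base_cover : \bigcup_(W in join_base) W = setT.
Proof.
rewrite -subTset => p _.
have h : [/\ 0 < 3%:R^-1 :> rat, 3%:R^-1 < 2%:R^-1 :> rat & 2%:R^-1 < 1 :> rat].
  by split.
case: h => h0 h1 h2.
case: p => [x|r x y|y].
- exists (join_setl 3%:R^-1 setT) => //; exists 3%:R^-1, 2%:R^-1, setT, setT.
  by split; [split=> //; exact: openT|constructor 1].
- have /andP[r0 r1] := valP r.
  have [lt|ge] := ltP (ratr 3%:R^-1) (val r).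
    exists (join_setl 3%:R^-1 setT) => //; exists 3%:R^-1, 2%:R^-1, setT, setT.
    by split; [split=> //; exact: openT|constructor 1].
  exists (join_setr 2%:R^-1 setT).
    exists 3%:R^-1, 2%:R^-1, setT, setT.
    by split; [split=> //; exact: openT|constructor 3].
  by split=> //; apply: le_lt_trans ge _; rewrite ltr_rat.
- exists (join_setr 2%:R^-1 setT) => //; exists 3%:R^-1, 2%:R^-1, setT, setT.
  by split; [split=> //; exact: openT|constructor 3].
Qed.

Lemma join_base_itv a b U V : 0 < a -> a < b -> b < 1 -> open U -> open V ->
  [/\ join_base (join_setl a U), join_base (join_setm a b U V) &
      join_base (join_setr b V)].
Proof.
move=> a0 ab b1 oU oV; split; exists a, b, U, V; split=> //.
- by constructor 1.
- by constructor 2.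
- by constructor 3.
Qed.

Lemma join_base_join (W W' : set (join R X Y)) p :
  join_base W -> join_base W' -> W p -> W' p ->
  exists W'', [/\ join_base W'', W'' p & W'' `<=` W `&` W'].
Proof.
move=> [a [b [U [V [[a0 ab b1 oU oV] h]]]]].
move=> [a' [b' [U' [V' [[a0' ab' b1' oU' oV'] h']]]]] Wp W'p.
have oUU := openI oU oU'; have oVV := openI oV oV'.
pose am := Order.max a a'; pose bm := Order.min b b'.
have am0 : 0 < am by rewrite lt_max a0.
have bm1 : bm < 1 by rewrite gt_min b1.
have amE (t : R) : ratr am < t = (ratr a < t) && (ratr a' < t).
  apply/idP/andP => [lt|[lt lt']]; last by rewrite /am; case: (leP a a').
  by split; apply: le_lt_trans lt; rewrite ler_rat le_max lexx ?orbT.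
have bmE (t : R) : t < ratr bm = (t < ratr b) && (t < ratr b').
  apply/idP/andP => [lt|[lt lt']]; last by rewrite /bm; case: (leP b b').
  by split; apply: lt_le_trans lt _; rewrite ler_rat ge_min lexx ?orbT.
have am1 : am < 1 by rewrite gt_max (lt_trans ab b1) (lt_trans ab' b1').
have bm0 : 0 < bm by rewrite lt_min (lt_trans a0 ab) (lt_trans a0' ab').
have baseL : join_base (join_setl am (U `&` U')).
  by have [|||||] := @join_base_itv am ((am + 1) / 2) (U `&` U') V => //; lra.
have baseR : join_base (join_setr bm (V `&` V')).
  by have [|||||] := @join_base_itv (bm / 2) bm U (V `&` V') => //; lra.
have baseM c d U0 V0 (r : oitv R) : 0 < c -> d < 1 -> open U0 -> open V0 ->
    ratr c < val r -> val r < ratr d -> join_base (join_setm c d U0 V0).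
  move=> c0 d1 oU0 oV0 cr rd.
  have cd : c < d by rewrite -(ltr_rat R); exact: lt_trans cr rd.
  by have [] := join_base_itv c0 cd d1 oU0 oV0.
case: h h' Wp W'p => -> [] -> //.
- move=> Wp W'p; exists (join_setl am (U `&` U')); split=> //.
    by case: p Wp W'p => //= r x _; rewrite amE => -[-> ?] [-> ?].
  by case=> //= r x y; rewrite amE => -[/andP[-> ->]] [].
- case: p => // r x y [ar Ux] [/andP[ar' rb'] [Ux' Vy']].
  exists (join_setm am b' (U `&` U') V'); split.
  + by apply: (baseM _ _ _ _ r) => //; rewrite amE ar.
  + by rewrite /= amE ar ar' rb'.
  + by case=> //= s x' y'; rewrite amE => -[/andP[/andP[-> ->] ->] [[]]].
- case: p => // r x y [ar Ux] [rb' Vy'].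
  exists (join_setm a b' U V'); split.
  + exact: (baseM _ _ _ _ r).
  + by rewrite /= ar rb'.
  + by case=> //= s x' y' [/andP[-> ->] []].
- case: p => // r x y [/andP[ar rb] [Ux Vy]] [ar' Ux'].
  exists (join_setm am b (U `&` U') V); split.
  + by apply: (baseM _ _ _ _ r) => //; rewrite amE ar.
  + by rewrite /= amE ar ar' rb.
  + by case=> //= s x' y'; rewrite amE => -[/andP[/andP[-> ->] ->] [[]]].
- case: p => // r x y [/andP[ar rb] [Ux Vy]] [/andP[ar' rb'] [Ux' Vy']].
  exists (join_setm am bm (U `&` U') (V `&` V')); split.
  + by apply: (baseM _ _ _ _ r) => //; rewrite ?amE ?bmE ?ar ?rb.
  + by rewrite /= amE bmE ar ar' rb rb'.
  + case=> //= s x' y'; rewrite amE bmE.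
    by move=> -[/andP[/andP[-> ->] /andP[-> ->]] [[? ?] []]].
- case: p => // r x y [/andP[ar rb] [Ux Vy]] [rb' Vy'].
  exists (join_setm a bm U (V `&` V')); split.
  + by apply: (baseM _ _ _ _ r) => //; rewrite bmE rb.
  + by rewrite /= bmE ar rb rb'.
  + by case=> //= s x' y'; rewrite bmE => -[/andP[-> /andP[-> ->]] [? []]].
- case: p => // r x y [rb Vy] [ar' Ux'].
  exists (join_setm a' b U' V); split.
  + exact: (baseM _ _ _ _ r).
  + by rewrite /= ar' rb.
  + by case=> //= s x' y' [/andP[-> ->] []].
- case: p => // r x y [rb Vy] [/andP[ar' rb'] [Ux' Vy']].
  exists (join_setm a' bm U' (V `&` V')); split.
  + by apply: (baseM _ _ _ _ r) => //; rewrite bmE rb.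
  + by rewrite /= bmE ar' rb rb'.
  + by case=> //= s x' y'; rewrite bmE => -[/andP[-> /andP[-> ->]] [? []]].
- move=> Wp W'p; exists (join_setr bm (V `&` V')); split=> //.
    by case: p Wp W'p => //= r x y; rewrite bmE => -[-> ?] [-> ?].
  by case=> //= r x y; rewrite bmE => -[/andP[-> ->]] [].
Qed.

HB.instance Definition _ := isBaseTopological.Build (join R X Y)
  join_base_cover
  (fun W W' p DW DW' Wp W'p => join_base_join DW DW' Wp W'p).

End JoinTopology.

Section JoinMaps.
Variable R : realType.

Definition join_map (X X' Y Y' : Type) (f : X -> X') (g : Y -> Y')
    (p : join R X Y) : join R X' Y' :=
  match p with
  | jl x => jl (f x)
  | jm r x y => jm r (f x) (g y)
  | jr y => jr (g y)
  end.

Definition join_assoc (X Y Z : Type) (p : join R (join R X Y) Z) :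
    join R X (join R Y Z) :=
  match p with
  | jl (jl x) => jl x
  | jl (jm s x y) => jm s x (jl y)
  | jl (jr y) => jr (jl y)
  | jm r (jl x) z => jm r x (jr z)
  | jm r (jm s x y) z => jm (oitv_mul r s) x (jm (oitv_mul_compl r s) y z)
  | jm r (jr y) z => jr (jm r y z)
  | jr z => jr (jr z)
  end.

Definition join_lunit (X : Type) (p : join R void X) : X :=
  match p with
  | jl v => match v with end
  | jm _ v _ => match v with end
  | jr x => x
  end.

Definition join_runit (X : Type) (p : join R X void) : X :=
  match p with
  | jl x => x
  | jm _ _ v => match v with end
  | jr v => match v with end
  end.

Definition join_symm (X Y : Type) (p : join R X Y) : join R Y X :=
  match p with
  | jl x => jr x
  | jm r x y => jm (oitv_compl r) y x
  | jr y => jl y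
  end.

(* Compactness and Hausdorffness of the join are an argument, as in KHradon
   below, so that objects of KH have the intended underlying spaces by
   construction. *)
Definition KHjoin
    (hJ : forall X Y : KHspace, compact_hausdorff (join R X Y))
    (X Y : KH) : KH := MkKH (hJ X Y).

(* The inverse constraints are determined by these equations. *)
Record is_join_monoidal hJ (J : sym_monoidal (KHjoin hJ) KH0) : Prop :=
  IsJoinMonoidal {
  join_tmapE : forall (X X' Y Y' : KH) (f : hom X X') (g : hom Y Y'),
    tmap J f g = join_map f g :> (_ -> _);
  join_assocE : forall X Y Z : KH,
    assoc J X Y Z = @join_assoc _ _ _ :> (_ -> _);
  join_lunitE : forall X : KH, lunit J X = @join_lunit _ :> (_ -> _);
  join_runitE : forall X : KH, runit J X = @join_runit _ :> (_ -> _);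
  join_symmE : forall X Y : KH, symm J X Y = @join_symm _ _ :> (_ -> _) }.

End JoinMaps.

(* Measurable types of the library are pointed; a space carrying a probability
   measure is nonempty, and any of its points makes it a measurable type whose
   measurable sets are the Borel sets. *)

Definition pointed_at (X : topologicalType) (x0 : X) : Type := X.

HB.instance Definition _ (X : topologicalType) (x0 : X) :=
  Choice.copy (pointed_at x0) X.
HB.instance Definition _ (X : topologicalType) (x0 : X) :=
  isPointed.Build (pointed_at x0) x0.

Definition borel (X : topologicalType) : set (set X) := <<s open >>.

Notation borelType x0 :=
  (g_sigma_algebraType (@open _ : set (set (pointed_at x0)))).

Section Radon.
Context {R : realType} {X : topologicalType}.

(* Only the values on Borel sets matter; the value 0 elsewhere is a
   normalisation making equality of measures the Leibniz equality. *)
Definition is_radon_probability (w : set X -> \bar R) : Prop :=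
  exists (x0 : X) (P : probability (borelType x0) R),
    [/\ forall M, borel M -> w M = P M,
        forall M, ~ borel M -> w M = 0%E &
        forall M, borel M ->
          w M = ereal_sup [set w K | K in [set K | compact K /\ K `<=` M]]].

Record radon := MkRadon {
  radon_val :> set X -> \bar R;
  radon_prop : is_radon_probability radon_val }.

End Radon.
Arguments radon R X : clear implicits.

HB.instance Definition _ R X := gen_eqMixin (radon R X).
HB.instance Definition _ R X := gen_choiceMixin (radon R X).

Section RadonIntegral.
Context {R : realType} {X : topologicalType}.

(* The chosen point and the chosen extension off the Borel sets do not affect
   integrals. *)
Definition radon_point (w : radon R X) : X := projT1 (cid (radon_prop w)).

Definition radon_proba (w : radon R X) :
    probability (borelType (radon_point w)) R :=
  projT1 (cid (projT2 (cid (radon_prop w)))).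

Definition radon_integral (w : radon R X) (f : X -> \bar R) : \bar R :=
  (\int[radon_proba w]_x f x)%E.

Definition radon_weak_topology :=
  sup_topology (fun f : {f : X -> R | continuous f} =>
    Topological.class (initial_topology (fun w : radon R X =>
      fine (radon_integral w (fun x => (sval f x)%:E))))).

End RadonIntegral.
Arguments radon_weak_topology R X : clear implicits.

HB.instance Definition _ (R : realType) (X : topologicalType) :=
  Topological.copy (radon R X) (radon_weak_topology R X).

Section RadonMonad.
Variable R : realType.

Definition KHradon
    (hR : forall X : KHspace, compact_hausdorff (radon R X)) (X : KH) : KH :=
  MkKH (hR X).

Record is_radon_monad hR (M : monad (KHradon hR)) : Prop := IsRadonMonad {
  radon_mapE : forall (X Y : KH) (f : hom X Y) (w : radon R X) (B : set Y),
    borel B -> fmap M f w B = w (f @^-1` B);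
  radon_etaE : forall (X : KH) (x : X) (B : set X),
    borel B -> eta M X x B = \d_(x : borelType x) B;
  radon_muE : forall (X : KH) (W : radon R (radon R X)) (B : set X),
    borel B -> mu M X W B = radon_integral W (fun t => t B) }.

End RadonMonad.

(* Main.v *)
Require Import Defs.
From HB Require Import structures.
From mathcomp Require Import all_boot all_order all_algebra.
From mathcomp Require Import all_classical all_reals all_analysis.
From mathcomp Require Import measurable_realfun ring lra.

(** Everything is tested against continuous real functions.  For f on X and g
    on Y put [f, g](r, x, y) = r f(x) + (1 - r) g(y) on X * Y; these functions
    separate the points of the join, and the integrals of continuous functions
    separate Radon measures.  A map into a compact Hausdorff space is
    continuous as soon as its composites with a separating family are, and two
    maps agree as soon as these composites do.  In these terms the structure
    reads
      [f, [g, h]] o assoc = [[f, g], h],    [f, g] o symm = [g, f],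
      [int f, int g] o ups = int [f, g],    int f o mu = int (int f),
    which makes all coherence conditions immediate.

    By the Riesz theorem a Radon probability measure is the same as a
    normalised positive functional on continuous functions; this yields the
    compactness of the space of measures (limits along ultrafilters of such
    functionals are such functionals), the multiplication mu and the splitting
    ups.  That mu(W)(B) is the integral of t(B) for Borel sets B is the
    continuity of W along the directed family of continuous functions below
    the indicator of an open set, followed by a pi-lambda argument.

    The cotuple of algebra maps f and g into (Z, z) sends (r, x, y) to the value
    of z at r d_(f x) + (1 - r) d_(g y).  It is forced, because ups maps
    r d_x + (1 - r) d_y to (r, d_x, d_y). *)

Set Implicit Arguments.
Unset Strict Implicit.
Unset Printing Implicit Defensive.

Import Order.TTheory GRing.Theory Num.Theory.
Import numFieldNormedType.Exports.

Local Open Scope classical_set_scope.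
Local Open Scope ring_scope.

(** * The join of compact Hausdorff spaces *)

Section ContinuousFunctions.
Context {R : realType} {X : topologicalType}.
Implicit Types f g : X -> R.

Lemma cts_cst (c : R) : continuous (fun _ : X => c).
Proof. by move=> x; exact: cvg_cst. Qed.

Lemma ctsD f g : continuous f -> continuous g ->
  continuous (fun x => f x + g x).
Proof. by move=> cf cg x; apply: cvgD; [exact: cf|exact: cg]. Qed.

Lemma ctsN f : continuous f -> continuous (fun x => - f x).
Proof. by move=> cf x; apply: cvgN; exact: cf. Qed.

Lemma ctsM f g : continuous f -> continuous g ->
  continuous (fun x => f x * g x).
Proof. by move=> cf cg x; apply: cvgM; [exact: cf|exact: cg]. Qed.

Lemma ctsB f g : continuous f -> continuous g ->
  continuous (fun x => f x - g x).
Proof. by move=> cf cg; apply: ctsD => //; exact: ctsN. Qed.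

Lemma ctsZ (c : R) f : continuous f -> continuous (fun x => c * f x).
Proof. by move=> cf; apply: ctsM => //; exact: cts_cst. Qed.

Lemma cts_max f g : continuous f -> continuous g ->
  continuous (fun x => Num.max (f x) (g x)).
Proof. by move=> cf cg x; apply: continuous_max; [exact: cf|exact: cg]. Qed.

Lemma cts_min f g : continuous f -> continuous g ->
  continuous (fun x => Num.min (f x) (g x)).
Proof. by move=> cf cg x; apply: continuous_min; [exact: cf|exact: cg]. Qed.

Lemma open_gt f (c : R) : continuous f -> open [set x | c < f x].
Proof.
move=> cf; rewrite (_ : [set x | _] = f @^-1` [set y | c < y])//.
by apply: open_comp; [move=> x _; exact: cf|exact: open_gt].
Qed.

Lemma open_lt f (c : R) : continuous f -> open [set x | f x < c].
Proof.
move=> cf; rewrite (_ : [set x | _] = f @^-1` [set y | y < c])//.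
by apply: open_comp; [move=> x _; exact: cf|exact: open_lt].
Qed.

Lemma closed_ge f (c : R) : continuous f -> closed [set x | c <= f x].
Proof.
move=> cf; rewrite (_ : [set x | _] = ~` [set x | f x < c]).
  by apply: open_closedC; exact: open_lt.
by apply/seteqP; split => x /=; rewrite leNgt => /negP.
Qed.

Hypothesis hX : compact_hausdorff X.

Lemma cts_bounded f : continuous f -> exists2 M : R, 0 < M & forall x, `|f x| <= M.
Proof.
move=> cf; have cK : compact (f @` setT).
  by apply: continuous_compact; [exact/continuous_subspaceT|case: hX].
have [M [_ MP]] := compact_bounded cK.
exists (`|M| + 1); first by rewrite ltr_wpDl.
move=> x; apply: (MP (`|M| + 1)); last by exists x.
by rewrite (le_lt_trans (ler_norm _))// ltrDl.
Qed.

Lemma closed_compactKH (A : set X) : closed A -> compact A.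
Proof. by move=> cA; apply: (subclosed_compact cA (proj1 hX)). Qed.

Lemma compact_closedKH (A : set X) : compact A -> closed A.
Proof. by apply: compact_closed; case: hX. Qed.

Lemma urysohnKH (A B : set X) : closed A -> closed B -> A `&` B = set0 ->
  exists f, [/\ continuous f, forall x, 0 <= f x <= 1,
    forall x, A x -> f x = 1 & forall x, B x -> f x = 0].
Proof.
move=> cA cB AB.
have nX : normal_space X by apply: compact_normal; case: hX.
have /normal_separatorP sepX := nX.
(* The separator is 0 on its first set and 1 on its second, hence the exchange of [A] and [B]. *)
have /uniform_separatorP : uniform_separator B A.
  by apply: (sepX R) => //; rewrite setIC.
move=> /(_ R)[f [cf f01 f0 f1]]; exists f; split => //.
- by move=> x; have /(_ (f x))/= := f01; rewrite in_itv/=; apply; exists x.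
- by move=> x Ax; apply: f1; exists x.
- by move=> x Ax; apply: f0; exists x.
Qed.

Lemma cts_separate (x y : X) : (forall f, continuous f -> f x = f y) -> x = y.
Proof.
move=> H; apply: contrapT => xy.
have aX : accessible_space X by apply: hausdorff_accessible; case: hX.
have c1 (z : X) : closed [set z] by exact: accessible_closed_set1.
have [|f [cf _ f1 f0]] := urysohnKH (c1 x) (c1 y).
  by apply/seteqP; split => z //= -[zx zy]; apply: xy; rewrite -zx.
by have := H f cf; rewrite f1// f0// => /eqP; rewrite oner_eq0.
Qed.

End ContinuousFunctions.

(** * Separating families of real functions *)

Section Separation.
Context {R : realType} {K : topologicalType}.

(** If all neighbourhoods of x and y meet, then so do those of f x and f y, and the real line is
    Hausdorff. *)
Lemma hausdorff_separate (Phi : set (K -> R)) :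
  (forall f, Phi f -> continuous f) ->
  (forall x y, (forall f, Phi f -> f x = f y) -> x = y) -> hausdorff_space K.
Proof.
move=> cP sP x y xy; apply: sP => f /cP cf.
apply: (@Rhausdorff R) => A B /= xA xB.
have [z [Az Bz]] := xy _ _ (cf x _ xA) (cf y _ xB).
by exists (f z).
Qed.

(* The cluster points of [g @ z] are mapped by each test function to the limit
   of its values. *)
Lemma cts_by_separate (Z : topologicalType) (g : Z -> K) (Phi : set (K -> R)) :
  compact_hausdorff K ->
  (forall f, Phi f -> continuous f) ->
  (forall x y, (forall f, Phi f -> f x = f y) -> x = y) ->
  (forall f, Phi f -> continuous (f \o g)) -> continuous g.
Proof.
move=> [cK hK] cP sP cPg z.
apply: (@compact_cluster_set1 K (g z) _ setT) => //.
- exact: filterT.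
- exact: filterT.
apply/seteqP; split => y /=; last first.
  by move=> -> A B /nbhs_singleton Az /nbhs_singleton Bz; exists (g z).
move=> yz; apply: sP => f Pf; apply: (@Rhausdorff R) => A B /= yA zB.
have [u [Bu Au]] := yz (f @^-1` B) (f @^-1` A) (cPg f Pf z _ zB) (cP f Pf y _ yA).
by exists (f u).
Qed.

End Separation.

(** * Test functions and topology of the join *)

Section JoinSpace.
Variable R : realType.

(* The function written [f, g] in the header. *)
Definition jpair (X Y : Type) (f : X -> R) (g : Y -> R) (p : join R X Y) : R :=
  match p with
  | jl x => f x
  | jm r x y => val r * f x + (1 - val r) * g y
  | jr y => g y
  end.

Lemma jpair_cst (X Y : Type) (c : R) (p : join R X Y) :
  jpair (fun=> c) (fun=> c) p = c.
Proof. by case: p => //= r x y; ring. Qed.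

Lemma jpair_join_map (X X' Y Y' : Type) (a : X -> X') (b : Y -> Y')
    (f : X' -> R) (g : Y' -> R) (p : join R X Y) :
  jpair f g (join_map a b p) = jpair (f \o a) (g \o b) p.
Proof. by case: p. Qed.

(** Under both bracketings x, y, z have the weights rs, r(1 - s), 1 - r: the denominator 1 - rs of
    the new inner coordinate cancels against the outer weight. *)
Lemma jpair_join_assoc (X Y Z : Type) (f : X -> R) (g : Y -> R) (h : Z -> R)
    (p : join R (join R X Y) Z) :
  jpair f (jpair g h) (join_assoc p) = jpair (jpair f g) h p.
Proof.
case: p => [[]//|r [x|s x y|y] z|]//=.
case: r s => [r /= /andP[r0 r1]] [s /= /andP[s0 s1]].
have rs1 : 1 - r * s != 0 by apply/eqP; nra.
by field.
Qed.

Lemma jpair_join_symm (X Y : Type) (f : X -> R) (g : Y -> R)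
    (p : join R X Y) : jpair g f (join_symm p) = jpair f g p.
Proof. by case: p => //= r x y; rewrite subKr addrC. Qed.

(* [jpair 1 0] is the coordinate of the interval, which selects the summand;
   the coordinates in [X] and [Y] are then recovered from [jpair f 0] and
   [jpair 0 g]. *)
Lemma jpair_separate (X Y : Type) (Phi : set (X -> R)) (Psi : set (Y -> R))
    (p q : join R X Y) :
  (forall c, Phi (fun=> c)) -> (forall c, Psi (fun=> c)) ->
  (forall x y, (forall f, Phi f -> f x = f y) -> x = y) ->
  (forall x y, (forall f, Psi f -> f x = f y) -> x = y) ->
  (forall f g, Phi f -> Psi g -> jpair f g p = jpair f g q) -> p = q.
Proof.
move=> cX cY sX sY pq.
have t := pq _ _ (cX 1) (cY 0).
have l f Pf := pq f _ Pf (cY 0).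
have r g Pg := pq _ g (cX 0) Pg.
case: p q {pq} l r t =>
  [x|[a /= a01] x y|y] [x'|[a' /= a'01] x' y'|y'] /= l r t;
  rewrite ?mulr0 ?mulr1 ?addr0 in t;
  try (by exfalso; move/eqP: t; rewrite ?oner_eq0 // eq_sym oner_eq0);
  try (by exfalso; move: a01; rewrite t ltxx ?andbF);
  try (by exfalso; move: a'01; rewrite -t ltxx ?andbF).
- by rewrite (sX x x').
- subst a'; have /andP[a0 a1] := a01.
  have -> : x = x'.
    apply: sX => f Pf; have := l f Pf; rewrite !mulr0 !addr0; apply: mulfI.
    by rewrite gt_eqF.
  have -> : y = y'.
    apply: sY => g Pg; have := r g Pg; rewrite !mulr0 !add0r; apply: mulfI.
    by rewrite gt_eqF// subr_gt0.
  by rewrite (bool_irrelevance a'01 a01).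
- by rewrite (sY y y').
Qed.

Section Topology.
Context {X Y : topologicalType}.
Hypotheses (hX : compact_hausdorff X) (hY : compact_hausdorff Y).

Lemma open_join_base (W : set (join R X Y)) : join_base W -> open W.
Proof.
move=> bW; exists [set W]; first by move=> _ ->.
by rewrite bigcup_set1.
Qed.

Lemma nbhs_join (p : join R X Y) (W A : set (join R X Y)) :
  join_base W -> W p -> W `<=` A -> nbhs p A.
Proof.
move=> /open_join_base oW Wp /filterS; apply.
exact: open_nbhs_nbhs.
Qed.

Lemma cts_into_join (Z : topologicalType) (h : Z -> join R X Y) :
  (forall W, join_base W -> open (h @^-1` W)) -> continuous h.
Proof.
move=> oh; apply/continuousP => W [D' D'b <-].
by rewrite preimage_bigcup; apply: bigcup_open => W' /D'b /oh.
Qed.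

Lemma nbhs_jl (x : X) (U : set X) (c : R) (A : set (join R X Y)) :
  open U -> U x -> c < 1 -> (forall x', U x' -> A (jl x')) ->
  (forall r x' y, c < val r -> U x' -> A (jm r x' y)) ->
  nbhs (jl x) A.
Proof.
move=> oU Ux c1 Al Am.
have [a] : exists a : rat, ratr a \in `]Num.max c 0, 1[.
  by apply: rat_in_itvoo; rewrite gt_max c1 ltr01.
rewrite in_itv/= gt_max -andbA => /and3P[ca a0 a1].
rewrite -[0](rmorph0 (@ratr R)) ltr_rat in a0.
rewrite -[1](rmorph1 (@ratr R)) ltr_rat in a1.
apply: (nbhs_join (W := join_setl a U)) => //.
  have a2 : a < (a + 1) / 2 by lra.
  have b1 : (a + 1) / 2 < 1 by lra.
  by have [] := join_base_itv R a0 a2 b1 oU (@openT Y).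
case=> [x'|r x' y|y] //=; first exact: Al.
by move=> [ar Ux']; apply: Am => //; exact: lt_trans ar.
Qed.

Lemma nbhs_jr (y : Y) (V : set Y) (c : R) (A : set (join R X Y)) :
  open V -> V y -> 0 < c -> (forall y', V y' -> A (jr y')) ->
  (forall r x y', val r < c -> V y' -> A (jm r x y')) ->
  nbhs (jr y) A.
Proof.
move=> oV Vy c0 Ar Am.
have [b] : exists b : rat, ratr b \in `]0, Num.min c 1[.
  by apply: rat_in_itvoo; rewrite lt_min c0 ltr01.
rewrite in_itv/= lt_min => /and3P[b0 bc b1].
rewrite -[0](rmorph0 (@ratr R)) ltr_rat in b0.
rewrite -[1](rmorph1 (@ratr R)) ltr_rat in b1.
apply: (nbhs_join (W := join_setr b V)) => //.
  have a0 : 0 < b / 2 by lra.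
  have ab : b / 2 < b by lra.
  by have [] := join_base_itv R a0 ab b1 (@openT X) oV.
case=> [x'|r x' y'|y'] //=; last exact: Ar.
by move=> [rb Vy']; apply: Am => //; exact: lt_trans bc.
Qed.

Lemma nbhs_jm (r : oitv R) (x : X) (y : Y) (U : set X) (V : set Y) (c : R)
    (A : set (join R X Y)) :
  open U -> U x -> open V -> V y -> 0 < c ->
  (forall r' x' y', `|val r - val r'| < c -> U x' -> V y' ->
     A (jm r' x' y')) ->
  nbhs (jm r x y) A.
Proof.
move=> oU Ux oV Vy c0 Am; have /= /andP[r0 r1] := valP r.
have [a] : exists a : rat, ratr a \in `]Num.max (val r - c) 0, val r[.
  by apply: rat_in_itvoo; rewrite gt_max r0 ltrBlDr ltrDl c0.
rewrite in_itv/= gt_max -andbA => /and3P[ca a0 ar].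
have [b] : exists b : rat, ratr b \in `]val r, Num.min (val r + c) 1[.
  by apply: rat_in_itvoo; rewrite lt_min r1 ltrDl c0.
rewrite in_itv/= lt_min => /and3P[rb bc b1].
have ab : a < b by rewrite -(ltr_rat R); exact: lt_trans rb.
rewrite -[0](rmorph0 (@ratr R)) ltr_rat in a0.
rewrite -[1](rmorph1 (@ratr R)) ltr_rat in b1.
apply: (nbhs_join (W := join_setm a b U V)).
- by have [] := @join_base_itv R X Y a b U V.
- by rewrite /= ar rb.
- case=> // r' x' y' /= [/andP[ar' rb'] [Ux' Vy']]; apply: Am => //.
  by rewrite /= ltr_distl; apply/andP; split; lra.
Qed.

(** Near an end of the join the coordinate in the opposite factor is arbitrary and only its weight
    is small, so continuity there rests on the bounds [M] and [N] that compactness provides. *)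
Lemma jpair_continuous (f : X -> R) (g : Y -> R) :
  continuous f -> continuous g -> continuous (jpair f g).
Proof.
move=> cf cg.
have [M M0 fM] := cts_bounded hX cf; have [N N0 gN] := cts_bounded hY cg.
have oU (x : X) (d : R) : open [set x' | `|f x - f x'| < d].
  apply: open_lt => z; apply: cvg_norm; apply: cvgB (cf z); exact: cvg_cst.
have oV (y : Y) (d : R) : open [set y' | `|g y - g y'| < d].
  apply: open_lt => z; apply: cvg_norm; apply: cvgB (cg z); exact: cvg_cst.
move=> p; apply/(@cvgrPdist_lt _ _ _ (nbhs p) (nbhs_filter p)) => e e0.
have MN0 : 0 < M + N by exact: addr_gt0.
(* The tolerance for the interval coordinate: differences of values of f and g are at most [M + N],
   so such a change of weight contributes at most e / 2. *)
have d0 : 0 < e / 2 / (M + N) by rewrite !divr_gt0.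
have e2 : 0 < e / 2 by rewrite divr_gt0.
have e4 : 0 < e / 4 by rewrite divr_gt0.
case: p => [x|r x y|y].
- apply: (nbhs_jl (oU x (e / 2)) (c := 1 - e / 2 / (M + N))) => /=.
  + by rewrite subrr normr0.
  + by rewrite ltrBlDr ltrDl.
  + by move=> x' /lt_trans; apply; lra.
  + move=> r x' y cr fx; have /= /andP[r0 r1] := valP r.
    have -> : f x - (sval r * f x' + (1 - sval r) * g y) =
       (f x - f x') + (1 - sval r) * (f x' - g y) by ring.
    apply: (le_lt_trans (ler_normD _ _)); rewrite normrM.
    rewrite [`|1 - _|]gtr0_norm ?subr_gt0//.
    have h : `|f x' - g y| <= M + N.
      by apply: (le_trans (ler_normB _ _)); apply: lerD.
    have : (1 - sval r) * (M + N) < e / 2.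
      by rewrite -ltr_pdivlMr//; lra.
    have : (1 - sval r) * `|f x' - g y| <= (1 - sval r) * (M + N).
      by apply: ler_wpM2l => //; lra.
    lra.
- apply: (nbhs_jm (oU x (e / 4)) _ (oV y (e / 4)) _ d0) => /=.
  + by rewrite subrr normr0.
  + by rewrite subrr normr0.
  + move=> r' x' y' rr' fx gy; have /= /andP[r0 r1] := valP r'.
    have -> : sval r * f x + (1 - sval r) * g y -
       (sval r' * f x' + (1 - sval r') * g y') =
       (sval r - sval r') * (f x - g y) +
       (sval r' * (f x - f x') + (1 - sval r') * (g y - g y')) by ring.
    apply: (le_lt_trans (ler_normD _ _)); rewrite normrM.
    have h : `|f x - g y| <= M + N.
      by apply: (le_trans (ler_normB _ _)); apply: lerD.
    have h1 : `|sval r - sval r'| * `|f x - g y| <= e / 2.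
      rewrite -(@mulfVK _ (M + N) _ (e / 2)) ?gt_eqF//.
      by apply: ler_pM => //; exact: ltW.
    have := ler_normD (sval r' * (f x - f x')) ((1 - sval r') * (g y - g y')).
    rewrite !normrM [`|1 - _|]gtr0_norm ?subr_gt0// [`|sval r'|]gtr0_norm//.
    have h2 : sval r' * `|f x - f x'| <= sval r' * (e / 4).
      by apply: ler_wpM2l; exact: ltW.
    have h3 : (1 - sval r') * `|g y - g y'| < (1 - sval r') * (e / 4).
      by rewrite ltr_pM2l// subr_gt0.
    lra.
- apply: (nbhs_jr (oV y (e / 2)) _ d0) => /=.
  + by rewrite subrr normr0.
  + by move=> y' /lt_trans; apply; lra.
  + move=> r x y' cr gy; have /= /andP[r0 r1] := valP r.
    have -> : g y - (sval r * f x + (1 - sval r) * g y') =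
       (g y - g y') - sval r * (f x - g y') by ring.
    apply: (le_lt_trans (ler_normB _ _)); rewrite normrM.
    rewrite [`|sval r|]gtr0_norm//.
    have h : `|f x - g y'| <= M + N.
      by apply: (le_trans (ler_normB _ _)); apply: lerD.
    have : sval r * (M + N) < e / 2 by rewrite -ltr_pdivlMr.
    have : sval r * `|f x - g y'| <= sval r * (M + N).
      by apply: ler_wpM2l => //; exact: ltW.
    lra.
Qed.

Lemma join_separate (p q : join R X Y) :
  (forall f g, continuous f -> continuous g -> jpair f g p = jpair f g q) ->
  p = q.
Proof.
apply: (jpair_separate (Phi := [set f | continuous f])
  (Psi := [set g | continuous g])) => //=.
- exact: cts_cst.
- exact: cts_cst.
- by move=> x y; exact: cts_separate.
- by move=> x y; exact: cts_separate.
Qed.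

Lemma jl_continuous : continuous (@jl R X Y).
Proof.
apply: cts_into_join => _ [a [b [U [V [[a0 ab b1 oU oV] [] ->]]]]] //.
- exact: open0.
- exact: open0.
Qed.

Lemma jr_continuous : continuous (@jr R X Y).
Proof.
apply: cts_into_join => _ [a [b [U [V [[a0 ab b1 oU oV] [] ->]]]]] //.
- exact: open0.
- exact: open0.
Qed.

(** The quotient map from [0, 1] * X * Y onto the join, extended to all real first coordinates by
    clamping, so that its domain is a plain product. *)
Definition join_quot (p : R * X * Y) : join R X Y :=
  if insub p.1.1 is Some r then jm (r : {r : R | 0 < r < 1}) p.1.2 p.2
  else if p.1.1 <= 0 then jr p.2 else jl p.1.2.

Lemma join_quot_continuous : continuous join_quot.
Proof.
have cr : continuous (fun p : R * X * Y => p.1.1).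
  by move=> p; apply: continuous_comp; exact: cvg_fst.
have cx : continuous (fun p : R * X * Y => p.1.2).
  by move=> p;
    apply: (@continuous_comp _ _ _ fst snd); [exact: cvg_fst|exact: cvg_snd].
have cy : continuous (fun p : R * X * Y => p.2) by move=> p; exact: cvg_snd.
have oX U : open U -> open [set p : R * X * Y | U p.1.2].
  by move=> oU; apply: open_comp => // p _; exact: cx.
have oY V : open V -> open [set p : R * X * Y | V p.2].
  by move=> oV; apply: open_comp => // p _; exact: cy.
apply: cts_into_join => W [a [b [U [V [[a0 ab b1 oU oV] h]]]]].
have b0 := lt_trans a0 ab; have a1 := lt_trans ab b1.
rewrite -(ltr_rat R) rmorph0 in a0; rewrite -(ltr_rat R) rmorph0 in b0.
rewrite -(ltr_rat R) rmorph1 in a1; rewrite -(ltr_rat R) rmorph1 in b1.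
(* Case analysis on the position of r relative to (0, 1), for an arbitrary predicate on the
   value. *)
have quotP (r : R) x y (P : join R X Y -> Prop) :
    (forall r01 : 0 < r < 1, P (jm (exist _ r r01) x y)) ->
    (r <= 0 -> P (jr y)) -> (1 <= r -> P (jl x)) -> P (join_quot (r, x, y)).
  move=> Pm Pr Pl; rewrite /join_quot /=.
  case: insubP => [[s s01] _ /= sr|]; first by subst s; exact: Pm.
  rewrite negb_and -!leNgt => h'; case: ifPn => [|r0]; first exact: Pr.
  by apply: Pl; case/orP: h' => // /negP; rewrite (negbTE r0).
case: h => ->.
- rewrite (_ : _ @^-1` _ = [set p | ratr a < p.1.1] `&` [set p | U p.1.2]).
    by apply: openI; [exact: open_gt|exact: oX].
  rewrite predeqE => -[[r x] y].
  apply: (quotP r x y (fun p => join_setl a U p <-> ratr a < r /\ U x)) => //= r1.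
  + by split => // -[ar]; have := lt_trans a0 ar; rewrite ltNge r1.
  + by split => [|[]//]; split => //; exact: lt_le_trans r1.
- rewrite (_ : _ @^-1` _ = [set p | ratr a < p.1.1] `&`
    [set p | p.1.1 < ratr b] `&` [set p | U p.1.2] `&` [set p | V p.2]).
    by repeat apply: openI; [exact: open_gt|exact: open_lt|exact: oX|exact: oY].
  rewrite predeqE => -[[r x] y].
  apply: (quotP r x y (fun p => join_setm a b U V p <->
    ((ratr a < r /\ r < ratr b) /\ U x) /\ V y)) => //= r1.
  + by split => [[/andP[-> ->] []]|[[[-> ->]]]].
  + by split => // -[[[ar]]]; have := lt_trans a0 ar; rewrite ltNge r1.
  + by split => // -[[[_ rb]]]; have := lt_trans rb b1; rewrite ltNge r1.
- rewrite (_ : _ @^-1` _ = [set p | p.1.1 < ratr b] `&` [set p | V p.2]).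
    by apply: openI; [exact: open_lt|exact: oY].
  rewrite predeqE => -[[r x] y].
  apply: (quotP r x y (fun p => join_setr b V p <-> r < ratr b /\ V y)) => //= r1.
  + by split => [|[]//]; split => //; exact: le_lt_trans b0.
  + by split => // -[rb]; have := lt_trans rb b1; rewrite ltNge r1.
Qed.

(** The ranges of [jl] and [jr] are added to the image of the quotient map because that image is
    empty when one of the factors is. *)
Lemma join_compact : compact [set: join R X Y].
Proof.
have -> : [set: join R X Y] =
    range jl `|` range jr `|` join_quot @` (`[0, 1] `*` setT `*` setT).
  apply/seteqP; split => // -[x|[r r01] x y|y] _; first by left; left; exists x.
    right; exists (r, x, y).
      by split => //; split => //=; rewrite in_itv/= !ltW//; case/andP: r01.
    by rewrite /join_quot/= insubT.
  by left; right; exists y.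
have [cX _] := hX; have [cY _] := hY.
apply: compactU; first apply: compactU.
- apply: continuous_compact => //; apply: continuous_subspaceT.
  exact: jl_continuous.
- apply: continuous_compact => //; apply: continuous_subspaceT.
  exact: jr_continuous.
- apply: continuous_compact.
    by apply: continuous_subspaceT; exact: join_quot_continuous.
  apply: compact_setX => //; apply: compact_setX => //.
  exact: segment_compact.
Qed.

Lemma join_compact_hausdorff : compact_hausdorff (join R X Y).
Proof.
split; first exact: join_compact.
apply: (@hausdorff_separate R _ [set h | exists f g,
   [/\ continuous f, continuous g & h = jpair f g]]).
  by move=> _ [f [g [cf cg ->]]]; exact: jpair_continuous.
move=> p q pq; apply: join_separate => f g cf cg.
by apply: pq; exists f, g.
Qed.

End Topology.
End JoinSpace.

(** * The Riesz representation theorem *)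

(** Equips a bare set function with the structure of a probability; the recorded equality allows
    passing back to the set function. *)
Lemma exists_probability d (T : measurableType d) (R : realType)
    (m : set T -> \bar R) :
  m set0 = 0%E -> (forall A, 0 <= m A)%E -> semi_sigma_additive m ->
  m setT = 1%E -> exists P : probability T R, P = m :> (set T -> \bar R).
Proof.
move=> m0 m_ge0 ms m1.
pose mm : measure T R := HB.pack m (isMeasure.Build _ T R m m0 m_ge0 ms).
pose P : probability T R := HB.pack m (Measure.class mm)
  (Measure_isProbability.Build _ T R mm m1).
by exists P.
Qed.

Section Riesz.
Context {R : realType} {X : topologicalType}.

(** Normalised positive linear functionals. [L] is total, but constrained only at continuous
    functions. *)
Record is_state (L : (X -> R) -> R) : Prop := IsState {
  state_linear : forall (a : R) (f g : X -> R), continuous f -> continuous g ->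
    L (fun x => a * f x + g x) = a * L f + L g;
  state_ge0 : forall f : X -> R, continuous f -> (forall x, 0 <= f x) -> 0 <= L f;
  state1 : L (fun=> 1) = 1 }.

Variable L : (X -> R) -> R.
Hypothesis LS : is_state L.
Hypothesis hX : compact_hausdorff X.
Implicit Types (f g : X -> R) (a e : R).

Lemma state0 : L (fun=> 0) = 0.
Proof.
have := state_linear LS 1 (@cts_cst R X 0) (@cts_cst R X 0).
by rewrite mulr0 addr0; lra.
Qed.

Lemma stateD f g : continuous f -> continuous g ->
  L (fun x => f x + g x) = L f + L g.
Proof.
move=> cf cg; rewrite -[L f]mul1r -(state_linear LS)//; congr L.
by apply/funext => x; rewrite mul1r.
Qed.

Lemma stateZ a f : continuous f -> L (fun x => a * f x) = a * L f.
Proof.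
move=> cf; rewrite -[RHS]addr0 -state0 -(state_linear LS)//; last exact: cts_cst.
by congr L; apply/funext => x; rewrite addr0.
Qed.

Lemma stateN f : continuous f -> L (fun x => - f x) = - L f.
Proof.
move=> cf; rewrite -mulN1r -stateZ//; congr L.
by apply/funext => x; rewrite mulN1r.
Qed.

Lemma stateB f g : continuous f -> continuous g ->
  L (fun x => f x - g x) = L f - L g.
Proof. by move=> cf cg; rewrite stateD ?stateN//; exact: ctsN. Qed.

Lemma state_cst a : L (fun=> a) = a.
Proof.
rewrite -[RHS]mulr1 -(state1 LS) -stateZ; last exact: cts_cst.
by congr L; apply/funext => x; rewrite mulr1.
Qed.

Lemma state_le f g : continuous f -> continuous g ->
  (forall x, f x <= g x) -> L f <= L g.
Proof.
move=> cf cg fg; rewrite -subr_ge0 -stateB//; apply: (state_ge0 LS).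
  exact: ctsB.
by move=> x; rewrite subr_ge0.
Qed.

(** These functions vanish outside U, while their closed support may leave U; truncation repairs
    this. *)
Definition below (U : set X) : set (X -> R) := [set f : X -> R |
  [/\ continuous f, forall x, 0 <= f x <= 1 & forall x, ~ U x -> f x = 0]].

Lemma below_subset U V : U `<=` V -> below U `<=` below V.
Proof. by move=> UV f [cf f01 fU]; split => // x Vx; apply: fU => /UV. Qed.

Lemma below0 U : below U (fun=> 0).
Proof. by split => //; [exact: cts_cst|move=> x; rewrite lexx ler01]. Qed.

(** For f below U the truncation lives on the closed, hence compact, set {f >= e} inside U, at a
    cost of at most e in the functional. *)
Definition trunc (e : R) (f : X -> R) := fun x => Num.max (f x - e) 0.

Lemma truncE e f x : trunc e f x = if f x <= e then 0 else f x - e.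
Proof.
rewrite /trunc; case: ifPn => [fe|].
  by rewrite max_r// subr_le0.
by rewrite -ltNge => fe; rewrite max_l// subr_ge0 ltW.
Qed.

Lemma trunc_continuous e f : continuous f -> continuous (trunc e f).
Proof.
move=> cf; apply: cts_max; last exact: cts_cst.
by apply: ctsB => //; exact: cts_cst.
Qed.

Lemma trunc_below e U f : 0 < e -> below U f -> below U (trunc e f).
Proof.
move=> e0 [cf f01 fU]; split; first exact: trunc_continuous.
  move=> x; have /andP[f0 f1] := f01 x; rewrite truncE.
  by case: ifPn => fe; [rewrite lexx ler01|lra].
by move=> x Ux; rewrite truncE fU// ltW.
Qed.

Lemma state_trunc e f : continuous f -> L f <= L (trunc e f) + e.
Proof.
move=> cf; have ct := trunc_continuous (e := e) cf.
have cc : continuous (fun _ : X => e) by exact: cts_cst.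
rewrite (_ : L (trunc e f) + e = L (fun x => trunc e f x + e)).
  apply: state_le => //; first exact: ctsD.
  by move=> x; rewrite -lerBlDr le_max lexx.
by rewrite stateD// state_cst.
Qed.

Local Open Scope ereal_scope.

(** The value of the representing measure on an open set; [riesz_outer] extends it to all sets by
    approximation from outside. *)
Definition rho (U : set X) : \bar R := ereal_sup [set (L f)%:E | f in below U].

Lemma rho_ge U f : below U f -> (L f)%:E <= rho U.
Proof. by move=> Uf; apply: ereal_sup_ubound; exists f. Qed.

Lemma rho_le U c : (forall f, below U f -> (L f)%:E <= c) -> rho U <= c.
Proof. by move=> h; apply: ge_ereal_sup => _ [f Uf <-]; exact: h. Qed.

Lemma rho_ge0 U : 0 <= rho U.
Proof. by apply: le_trans (rho_ge (below0 U)); rewrite state0. Qed.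

Lemma rho_le1 U : rho U <= 1.
Proof.
apply: rho_le => f [cf f01 _]; rewrite lee_fin -[leRHS](state1 LS).
by apply: state_le => // [|x]; [exact: cts_cst|case/andP: (f01 x)].
Qed.

Lemma rho_subset U V : U `<=` V -> rho U <= rho V.
Proof.
by move=> UV; apply: rho_le => f /(below_subset UV); exact: rho_ge.
Qed.

Lemma rho0 : rho set0 = 0.
Proof.
apply/eqP; rewrite eq_le rho_ge0 andbT; apply: rho_le => f [_ _ f0].
rewrite (_ : f = fun=> 0%R) ?state0//.
by apply/funext => x; rewrite f0.
Qed.

Lemma rhoT : rho setT = 1.
Proof.
apply/eqP; rewrite eq_le rho_le1/=.
apply: (@le_trans _ _ (L (fun=> 1))%:E); first by rewrite (state1 LS).
apply: rho_ge.
by split => [|x|x []//]; [exact: cts_cst|rewrite lexx ler01].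
Qed.

Lemma rho_trunc U c :
  (forall e f, (0 < e)%R -> below U f -> (L (trunc e f))%:E <= c) -> rho U <= c.
Proof.
move=> h; apply/lee_addgt0Pr => e e0; apply: rho_le => f Uf.
apply: (@le_trans _ _ ((L (trunc e f))%:E + e%:E)); last by rewrite leeD2r// h.
by rewrite -EFinD lee_fin; apply: state_trunc; case: Uf.
Qed.

(* A function supported in [{f >= e}] is split by a Urysohn function separating
   [{f >= e} \ V] from the complement of [U]. *)
Lemma rhoU U V : open U -> open V -> rho (U `|` V) <= rho U + rho V.
Proof.
move=> oU oV; apply: rho_trunc => e f e0 UVf.
have [cf f01 f0] := UVf; have [cg g01 g0] := trunc_below e0 UVf.
have [|||p [cp p01 p1 p0]] := urysohnKH (R := R) hX
  (A := [set x | (e <= f x)%R] `&` ~` V) (B := ~` U).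
- by apply: closedI; [exact: closed_ge|exact: open_closedC].
- exact: open_closedC.
- apply/seteqP; split => x //= [[ef Vx] Ux]; move: ef; rewrite f0; last by case.
  by rewrite leNgt e0.
have q01 x : (0 <= 1 - p x <= 1)%R.
  by have /andP[? ?] := p01 x; apply/andP; split; lra.
have m01 (a b : R) : (0 <= a <= 1 -> 0 <= b <= 1 -> 0 <= a * b <= 1)%R.
  move=> /andP[a0 a1] /andP[b0 b1]; rewrite mulr_ge0//=.
  exact: mulr_ile1.
have -> : trunc e f = (fun x => trunc e f x * p x + trunc e f x * (1 - p x))%R.
  by apply/funext => x; ring.
rewrite stateD; last 2 first.
- exact: ctsM.
- by apply: ctsM => //; apply: ctsB => //; exact: cts_cst.
rewrite EFinD; apply: leeD; apply: rho_ge; split.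
- exact: ctsM.
- by move=> x; exact: m01.
- by move=> x Ux; rewrite p0// mulr0.
- by apply: ctsM => //; apply: ctsB => //; exact: cts_cst.
- by move=> x; exact: m01.
- move=> x Vx; rewrite truncE; case: ifPn => [|]; first by rewrite mul0r.
  rewrite -ltNge => fe; rewrite p1 ?subrr ?mulr0//; split => //.
  exact: ltW.
Qed.

Lemma rho_bigU (U : (set X)^nat) n : (forall i, open (U i)) ->
  rho (\big[setU/set0]_(i < n) U i) <= \sum_(i < n) rho (U i).
Proof.
move=> oU; elim: n => [|n IH]; first by rewrite !big_ord0 rho0.
rewrite !big_ord_recr/=; apply: (le_trans (rhoU _ (oU n))).
  by rewrite -bigcup_mkord; apply: bigcup_open.
by rewrite leeD2r.
Qed.

(** Finitely many of the sets cover the compact set {f >= e}, so the truncation of f lies below a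
    finite union and finite subadditivity applies. *)
Lemma rho_bigcup (U : (set X)^nat) : (forall i, open (U i)) ->
  rho (\bigcup_i U i) <= \sum_(i <oo) rho (U i).
Proof.
move=> oU; apply: rho_trunc => e f e0 UVf.
have [cf f01 f0] := UVf; have [cg g01 g0] := trunc_below e0 UVf.
have /compact_near_coveringP cK : compact [set x | (e <= f x)%R].
  by apply: closed_compactKH => //; exact: closed_ge.
(* Compactness in terms of filters: for all large n the union of the first n sets contains {f >=
   e}. *)
have [|n _ /(_ n (leqnn n)) Kn] :=
  cK nat \oo (fun n x => (\big[setU/set0]_(i < n) U i) x) _.
- move=> x /= ef.
  have [i _ Uix] : (\bigcup_i U i) x.
    by apply: contrapT => /f0 fx; move: ef; rewrite fx leNgt e0.
  exists (U i, [set n | (i < n)%N]).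
    split; first by apply: open_nbhs_nbhs; split; first exact: oU.
    by exists i.+1.
  move=> [y n] /= [Uiy lt_in]; rewrite -bigcup_mkord.
  by exists i.
apply: (@le_trans _ _ (rho (\big[setU/set0]_(i < n) U i))).
  apply: rho_ge; split => // x Ux; rewrite truncE; case: ifPn => //.
  rewrite -ltNge => /ltW /Kn; rewrite /= => h.
  by exfalso; apply: Ux; exact: h.
apply: (le_trans (rho_bigU _ oU)).
rewrite -(big_mkord xpredT (fun i => rho (U i))).
by apply: nneseries_lim_ge => *; exact: rho_ge0.
Qed.

Definition riesz_outer (A : set X) : \bar R :=
  ereal_inf [set rho U | U in [set U | open U /\ A `<=` U]].

Lemma riesz_outer_le A U : open U -> A `<=` U -> riesz_outer A <= rho U.
Proof. by move=> oU AU; apply: ereal_inf_lbound; exists U. Qed.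

Lemma riesz_outer_open U : open U -> riesz_outer U = rho U.
Proof.
move=> oU; apply/eqP; rewrite eq_le riesz_outer_le//=.
by apply: le_ereal_inf_tmp => _ [V [oV UV] <-]; exact: rho_subset.
Qed.

Lemma riesz_outer_ge0 A : 0 <= riesz_outer A.
Proof. by apply: le_ereal_inf_tmp => _ [V _ <-]; exact: rho_ge0. Qed.

Lemma riesz_outer_subset : {homo riesz_outer : A B / A `<=` B >-> A <= B}.
Proof.
move=> A B AB; apply: le_ereal_inf_tmp => _ [V [oV BV] <-].
by apply: riesz_outer_le => //; exact: subset_trans BV.
Qed.

Lemma riesz_outerT : riesz_outer setT = 1.
Proof. by rewrite riesz_outer_open ?rhoT//; exact: openT. Qed.

Lemma riesz_outer_fin A : riesz_outer A \is a fin_num.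
Proof.
rewrite ge0_fin_numE ?riesz_outer_ge0//.
by rewrite (le_lt_trans (riesz_outer_subset (@subsetT _ A)))// riesz_outerT ltry.
Qed.

Lemma riesz_outer_adherent A e : (0 < e)%R ->
  exists U, [/\ open U, A `<=` U & rho U <= riesz_outer A + e%:E].
Proof.
move=> e0.
have [_ [U [oU AU] <-] Ue] := lb_ereal_inf_adherent e0 (riesz_outer_fin A).
by exists U; split => //; exact: ltW.
Qed.

Lemma riesz_outer0 : riesz_outer set0 = 0.
Proof. by rewrite riesz_outer_open ?rho0//; exact: open0. Qed.

Lemma riesz_outer_sigma_subadditive : sigma_subadditive riesz_outer.
Proof.
move=> A; apply/lee_addgt0Pr => e e0.
have e2 n : (0 < e / (2 ^ n.+1)%:R)%R.
  by rewrite divr_gt0// ltr0n expn_gt0.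
have /choice[U UP] : forall n, exists U, [/\ open U, A n `<=` U &
    rho U <= riesz_outer (A n) + (e / (2 ^ n.+1)%:R)%:E].
  by move=> n; exact: riesz_outer_adherent.
apply: (@le_trans _ _ (rho (\bigcup_n U n))).
  apply: riesz_outer_le.
    by apply: bigcup_open => n _; case: (UP n).
  by apply: subset_bigcup => n _; case: (UP n).
apply: (le_trans (rho_bigcup _)); first by move=> n; case: (UP n).
apply: (@le_trans _ _ (\sum_(n <oo) (riesz_outer (A n) + (e / (2 ^ n.+1)%:R)%:E))).
  apply: lee_nneseries => [n _ _|n _]; first exact: rho_ge0.
  by case: (UP n).
by apply: epsilon_trick; [move=> n; exact: riesz_outer_ge0|exact: ltW].
Qed.

(** Open sets satisfy the Caratheodory condition. Given V open around A and f below V and U, the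
    part of A outside U lies in the open set [W] where f < e. For h below [W] one of h and the
    truncation of f vanishes at each point, so their sum is still below V. *)
Lemma riesz_outer_open_split U A : open U ->
  riesz_outer (A `&` U) + riesz_outer (A `&` ~` U) <= riesz_outer A.
Proof.
move=> oU; apply: le_ereal_inf_tmp => _ [V [oV AV] <-].
apply: (@le_trans _ _ (rho (V `&` U) + riesz_outer (A `&` ~` U))).
  rewrite leeD2r//; apply: riesz_outer_le; first exact: openI.
  by apply: setSI.
rewrite -leeBrDr ?riesz_outer_fin//; apply: rho_trunc => e f e0 VUf.
rewrite leeBrDr ?riesz_outer_fin// -leeBrDl//.
have [cf f01 f0] := VUf; have [cg g01 g0] := trunc_below e0 VUf.
pose W := V `&` [set x | (f x < e)%R].
have oW : open W by apply: openI => //; exact: open_lt.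
apply: (@le_trans _ _ (rho W)).
  apply: riesz_outer_le => // x [Ax Ux]; split; first exact: AV.
  by rewrite /= f0// => -[].
apply: rho_le => h [ch h01 h0]; rewrite leeBrDl// -EFinD -(stateD cg ch).
apply: rho_ge; split; first exact: ctsD.
- move=> x; rewrite truncE; case: ifPn => [fe|].
    by rewrite add0r.
  rewrite -ltNge => fe; rewrite h0 ?addr0.
    by have /andP[? ?] := f01 x; apply/andP; split; lra.
  by move=> [_ /=]; rewrite ltNge (ltW fe).
- move=> x Vx; rewrite g0 ?h0 ?addr0//; first by case.
  by move=> [].
Qed.

Definition riesz_outer_measure : outer_measure R X :=
  HB.pack riesz_outer (isOuterMeasure.Build R X riesz_outer riesz_outer0
    riesz_outer_ge0 riesz_outer_subset riesz_outer_sigma_subadditive).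

Variable x0 : X.

Let borel_caratheodory (M : set X) : borel M -> riesz_outer.-caratheodory M.
Proof.
apply: smallest_sub; last first.
  move=> U oU; apply: (@le_caratheodory_measurable _ _ riesz_outer_measure).
  by move=> A; exact: riesz_outer_open_split.
split.
- exact: (caratheodory_measurable_set0 riesz_outer_measure).
- move=> A mA; rewrite setTD.
  exact: (@caratheodory_measurable_setC _ _ riesz_outer_measure).
- exact: (@caratheodory_measurable_bigcup _ _ riesz_outer_measure).
Qed.

Let riesz_sigma_additive :
  semi_sigma_additive (riesz_outer : set (borelType x0) -> \bar R).
Proof.
move=> A mA tA mbigA.
apply: (@caratheodory_measure_sigma_additive _ (pointed_at x0)
  riesz_outer_measure) => //.
- by move=> n; exact: borel_caratheodory (mA n).
- exact: borel_caratheodory mbigA.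
Qed.

Lemma riesz_probability :
  exists P : probability (borelType x0) R, P = riesz_outer :> (set X -> \bar R).
Proof.
apply: exists_probability.
- exact: riesz_outer0.
- exact: riesz_outer_ge0.
- exact: riesz_sigma_additive.
- exact: riesz_outerT.
Qed.

End Riesz.

Section StateEq.
Context {R : realType} {X : topologicalType}.
Implicit Types f : X -> R.

(** Affine rescaling extends the inequality to all continuous functions; applied to f and to -f it
    becomes an equality. *)
Lemma state_eq (L I : (X -> R) -> R) : compact_hausdorff X ->
  is_state L -> is_state I ->
  (forall f, continuous f -> (forall x, 0 <= f x <= 1) -> L f <= I f) ->
  forall f, continuous f -> L f = I f.
Proof.
move=> hX LS IS LI.
suff le f : continuous f -> L f <= I f.
  move=> f cf; apply/eqP; rewrite eq_le le//= -lerN2.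
  by rewrite -(stateN LS cf) -(stateN IS cf) le//; exact: ctsN.
move=> cf; have [M M0 fM] := cts_bounded hX cf.
have cM : continuous (fun _ : X => M) by exact: cts_cst.
have cfM : continuous (fun x => f x + M) by exact: ctsD.
(* The affine map taking [-M, M] to [0, 1]. *)
have := LI (fun x => (2 * M)^-1 * (f x + M)).
rewrite !stateZ// !stateD// !state_cst//.
rewrite ler_pM2l ?invr_gt0 ?mulr_gt0// lerD2r; apply; first exact: ctsZ.
move=> x; have := fM x; rewrite ler_norml => /andP[h1 h2].
rewrite mulrC ler_pdivlMr ?mulr_gt0// ler_pdivrMr ?mulr_gt0//.
by apply/andP; split; lra.
Qed.

End StateEq.

(** * Layer-cake estimates: integrals against sums of measures of level sets *)

Section LayerCake.
Context {R : realType}.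

(** The sum counts the positive integers up to n that are smaller than u; this and the next lemma
    place it between u - 1 and u. *)
Lemma layer_count_le n (u : R) : 0 <= u ->
  \sum_(k < n) ((k.+1%:R < u)%R)%:R <= u.
Proof.
move=> u0; elim: n => [|n IH]; first by rewrite big_ord0.
rewrite big_ord_recr/=; have [nu|_] := ltP n.+1%:R u; last by rewrite addr0.
apply: le_trans (ltW nu); rewrite -natr1 lerD2r.
rewrite -[n in leRHS]card_ord -sumr_const.
by apply: ler_sum => i _; case: (_ < _).
Qed.

Lemma layer_count_ge n (u : R) : u <= n.+1%:R ->
  u <= 1 + \sum_(k < n) ((k.+1%:R < u)%R)%:R.
Proof.
elim: n => [|n IH] un; first by rewrite big_ord0 addr0.
have [nu|/IH] := ltP n.+1%:R u; last first.
  by move=> h; apply: (le_trans h); rewrite lerD2l big_ord_recr/= lerDl.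
apply: (le_trans un); rewrite -natr1 addrC lerD2l.
rewrite -[n.+1 in leLHS]card_ord -sumr_const.
apply: ler_sum => i _; rewrite (le_lt_trans _ nu)//.
by rewrite ler_nat ltn_ord.
Qed.

(** The summand with index k is the length of the part of [0, u] in the slice [k, k + 1]; the
    partial sums are min(u, n). *)
Lemma layer_sum n (u : R) : 0 <= u -> u <= n%:R ->
  u = \sum_(k < n) Num.min (Num.max (u - k%:R) 0) 1.
Proof.
move=> u0 un; suff -> : \sum_(k < n) Num.min (Num.max (u - k%:R) 0) 1 =
    Num.min u n%:R by rewrite min_l.
elim: n {un} => [|n IH]; first by rewrite big_ord0 min_r.
rewrite big_ord_recr/= IH -natr1.
case: (leP u n%:R) => h; case: (leP (u - n%:R) 0) => h1; case: leP => h2;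
  case: leP => h3; lra.
Qed.

Context d (T : measurableType d) (P : probability T R) (s : T -> R).
Hypotheses (ms : measurable_fun setT s) (s01 : forall x, 0 <= s x <= 1).
Variable n : nat.

Local Open Scope ereal_scope.

Let A (k : nat) : set T := [set x | k.+1%:R < n%:R * s x]%R.

Let mA k : measurable (A k).
Proof.
have mns : measurable_fun setT (fun x => n%:R * s x)%R by exact: measurable_funM.
have := mns measurableT `]k.+1%:R, +oo[%classic (measurable_itv _).
rewrite setTI (_ : _ @^-1` _ = A k)//.
by apply/seteqP; split => x /=; rewrite in_itv/= andbT.
Qed.

Let sumA x : (\sum_(k < n) ((k.+1%:R < n%:R * s x)%R)%:R : R)%R%:E =
  \sum_(k < n) (\1_(A k) x)%:E.
Proof.
rewrite sumEFin; congr EFin; apply: eq_bigr => k _.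
by rewrite indicE mem_setE.
Qed.

Let int_sumA : \int[P]_x (\sum_(k < n) (\1_(A k) x)%:E) = \sum_(k < n) P (A k).
Proof.
rewrite ge0_integral_sum//.
- by apply: eq_bigr => k _; rewrite integral_indic// setIT.
- by move=> k; apply/measurable_EFinP; exact: measurable_indic.
Qed.

Lemma layer_cake_le :
  \sum_(k < n) P (A k) <= n%:R%:E * \int[P]_x (s x)%:E.
Proof.
have [s0 s1] : (forall x, 0 <= s x)%R /\ (forall x, s x <= 1)%R.
  by split => x; case/andP: (s01 x).
rewrite -int_sumA -ge0_integralZl//; last 2 first.
- exact/measurable_EFinP.
- by move=> x _; rewrite lee_fin.
apply: ge0_le_integral => //.
- by move=> x _; apply: sume_ge0 => k _; rewrite lee_fin.
- by apply: emeasurable_sum => k; apply/measurable_EFinP; exact: measurable_indic.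
- by apply/measurable_EFinP; exact: measurable_funM.
- move=> x _; rewrite -sumA -EFinM lee_fin; apply: layer_count_le.
  by rewrite mulr_ge0.
Qed.

(** The count of levels falls short of n s(x) by at most 1 at each point, and 1 integrates to 1. *)
Lemma layer_cake_ge :
  n%:R%:E * \int[P]_x (s x)%:E <= 1 + \sum_(k < n) P (A k).
Proof.
have [s0 s1] : (forall x, 0 <= s x)%R /\ (forall x, s x <= 1)%R.
  by split => x; case/andP: (s01 x).
have i1 : \int[P]_x (cst 1%E x) = 1.
  by rewrite integral_cst// [X in _ * X]probability_setT mule1.
rewrite -int_sumA -ge0_integralZl//; last 2 first.
- exact/measurable_EFinP.
- by move=> x _; rewrite lee_fin.
have msum : measurable_fun setT (fun x => \sum_(k < n) (\1_(A k) x : R)%:E).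
  by apply: emeasurable_sum => k; apply/measurable_EFinP; exact: measurable_indic.
rewrite -[X in X + _]i1 -ge0_integralD//; last first.
  by move=> x _; apply: sume_ge0 => k _; rewrite lee_fin.
apply: ge0_le_integral => //.
- by move=> x _; rewrite -EFinM lee_fin mulr_ge0.
- by apply/measurable_EFinP; exact: measurable_funM.
- exact: emeasurable_funD.
- move=> x _; rewrite -sumA -EFinM -EFinD lee_fin; apply: layer_count_ge.
  by rewrite -natr1 -[leLHS]addr0 lerD// ler_piMr.
Qed.

End LayerCake.

(** * Borel probability measures and integrals of continuous functions *)

Section BorelProbability.
Context {R : realType} {X : topologicalType}.
Implicit Types f : X -> R.
Hypothesis hX : compact_hausdorff X.

Lemma borel_open (U : set X) : open U -> borel U.
Proof. exact: sub_sigma_algebra. Qed.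

Lemma borel_setC (M : set X) : borel M -> borel (~` M).
Proof.
have [_ bC _] := smallest_sigma_algebra [set: X] (@open X).
by move=> /bC; rewrite setTD.
Qed.

Lemma borel_closed (C : set X) : closed C -> borel C.
Proof.
move=> cC; rewrite -[C]setCK; apply: borel_setC; apply: borel_open.
exact: closed_openC.
Qed.

Section Fixed.
Variable x0 : X.
Variable P : probability (borelType x0) R.

Lemma cts_measurable f : continuous f ->
  measurable_fun [set: borelType x0] (f : borelType x0 -> R).
Proof.
move=> cf; apply: (measurability (@RGenOInfty.G R)).
  exact: RGenOInfty.measurableE.
move=> _ [_ [a ->] <-]; rewrite setTI; apply: borel_open.
rewrite (_ : _ @^-1` _ = [set x | a < f x]); first exact: open_gt.
by apply/seteqP; split => x /=; rewrite in_itv/= andbT.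
Qed.

Lemma cts_integrable f : continuous f -> P.-integrable setT (EFin \o f).
Proof.
move=> cf; apply: measurable_bounded_integrable => //.
- by rewrite [X in (X < _)%E](probability_setT P) ltry.
- exact: cts_measurable.
- have [M M0 fM] := cts_bounded hX cf.
  exists M; split; first exact: num_real.
  by move=> y My x _; apply: (le_trans (fM x)); exact: ltW.
Qed.

Lemma Rintegral_state : is_state (fun f => \int[P]_x f x).
Proof.
split => [a f g cf cg|f cf f0|].
- rewrite RintegralD//; last 2 first.
  + by apply: cts_integrable; exact: ctsZ.
  + exact: cts_integrable.
  by rewrite RintegralZl//; exact: cts_integrable.
- exact: Rintegral_ge0.
- by rewrite Rintegral_cst// [X in fine X](probability_setT P) mul1r.
Qed.

End Fixed.

(** The Borel structures pointed at x0 and at y0 are different types. The identity between them is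
    measurable, and the change of variables along it turns one integral into the other. *)
Lemma ge0_integral_borel_eq (x0 y0 : X) (P : probability (borelType x0) R)
    (Q : probability (borelType y0) R) (h : X -> \bar R) :
  (forall M, borel M -> P M = Q M) ->
  measurable_fun [set: borelType y0] (h : borelType y0 -> \bar R) ->
  (forall x, 0 <= h x)%E -> (\int[P]_x h x = \int[Q]_x h x)%E.
Proof.
move=> PQ mh h0.
have mid : measurable_fun [set: borelType x0] (id : borelType x0 -> borelType y0).
  by move=> _ M mM; rewrite setTI.
have := @ge0_integral_pushforward _ _ (borelType x0) (borelType y0) R id mid P
  setT (h : borelType y0 -> \bar R) measurableT.
rewrite preimage_setT => <-//.
by apply: eq_measure_integral => M mM _; rewrite /pushforward; exact: PQ.
Qed.

Lemma Rintegral_borel_eq (x0 y0 : X) (P : probability (borelType x0) R)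
    (Q : probability (borelType y0) R) f :
  (forall M, borel M -> P M = Q M) -> continuous f ->
  \int[P]_x f x = \int[Q]_x f x.
Proof.
move=> PQ; apply: (state_eq hX (Rintegral_state P) (Rintegral_state Q)).
move=> g cg g01; rewrite /Rintegral (@ge0_integral_borel_eq x0 y0 P Q)//.
  by apply/measurable_EFinP; exact: cts_measurable.
by move=> x; rewrite lee_fin; case/andP: (g01 x).
Qed.

Definition rint (w : radon R X) f : R :=
  fine (radon_integral w (fun x => (f x)%:E)).

Lemma rint_state (w : radon R X) : is_state (rint w).
Proof. exact: (Rintegral_state (radon_proba w)). Qed.

Lemma radon_probaE (w : radon R X) M : borel M -> w M = radon_proba w M.
Proof. by have [+ _ _] := projT2 (cid (projT2 (cid (radon_prop w)))); exact. Qed.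

Lemma radon_out (w : radon R X) M : ~ borel M -> w M = 0%E.
Proof. by case: w => w /= [x0 [P [_ + _]]]; exact. Qed.

Lemma radon_regular (w : radon R X) M : borel M ->
  w M = ereal_sup [set w K | K in [set K | compact K /\ K `<=` M]].
Proof. by case: w => w /= [x0 [P [_ _ +]]]; exact. Qed.

(** The epsilon form of inner regularity yields the supremum form; values off the Borel sets are
    reset to 0, as [radon] demands. *)
Lemma radon_of_probability (x0 : X) (P : probability (borelType x0) R) :
  (forall (M : set X) (e : R), borel M -> (0 < e)%R ->
     exists K, [/\ compact K, K `<=` M & P M <= P K + e%:E])%E ->
  exists w : radon R X, (forall M, borel M -> w M = P M) /\
    (forall f, continuous f -> rint w f = \int[P]_x f x).
Proof.
move=> reg; pose w M := if `[< borel M >] then P M else 0%E.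
have wE M : borel M -> w M = P M by move=> bM; rewrite /w asboolT.
have wP : is_radon_probability w.
  exists x0, P; split => // M bM; first by rewrite /w asboolF.
  apply/eqP; rewrite eq_le; apply/andP; split.
    apply/lee_addgt0Pr => e e0; have [K [cK KM Me]] := reg M e bM e0.
    rewrite wE//; apply: (le_trans Me); rewrite leeD2r//.
    apply: ereal_sup_ubound; exists K => //.
    by rewrite wE//; apply: borel_closed; exact: compact_closedKH.
  apply: ge_ereal_sup => _ [K [cK KM] <-].
  have bK : borel K by apply: borel_closed; exact: compact_closedKH.
  by rewrite !wE//; apply: le_measure => //; rewrite inE.
exists (MkRadon wP); split => // f cf.
apply: (Rintegral_borel_eq _ cf) => M bM.
by rewrite -radon_probaE//= wE.
Qed.

End BorelProbability.
Arguments rint {R X} w f.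

(** * The representing measure of a state *)

Section RieszTheorem.
Context {R : realType} {X : topologicalType}.
Implicit Types f : X -> R.
Hypothesis hX : compact_hausdorff X.
Variable L : (X -> R) -> R.
Hypothesis LS : is_state L.

Lemma state_sum n (F : nat -> X -> R) : (forall k, continuous (F k)) ->
  continuous (fun x => \sum_(k < n) F k x) /\
  L (fun x => \sum_(k < n) F k x) = \sum_(k < n) L (F k).
Proof.
move=> cF; elim: n => [|n [cn IH]].
  rewrite big_ord0; under eq_fun do rewrite big_ord0.
  by split; [exact: cts_cst|rewrite (state0 LS)].
rewrite big_ord_recr/= -IH -(stateD LS)//.
under eq_fun do rewrite big_ord_recr/=.
by split => //; exact: ctsD.
Qed.

(** The function (n + 1) f is the sum of slices [F k] with values in [0, 1]. The first slice
    contributes at most 1; the slice [F k.+1] is below the open set {(n + 1) f > k + 1}, so [L] is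
    bounded there by the measure of that set. The layer-cake estimate turns these measures into the
    integral, and the error 1 disappears after division by n + 1. *)
Lemma riesz_le (x0 : X) (P : probability (borelType x0) R) f :
  P = riesz_outer L :> (set X -> \bar R) ->
  continuous f -> (forall x, 0 <= f x <= 1) -> L f <= \int[P]_x f x.
Proof.
move=> PE cf f01.
have key n : n.+1%:R * L f <= 1 + n.+1%:R * \int[P]_x f x.
  pose F k x := Num.min (Num.max (n.+1%:R * f x - k%:R) 0) 1.
  have cF k : continuous (F k).
    apply: cts_min; last exact: cts_cst.
    apply: cts_max; last exact: cts_cst.
    by apply: ctsB; [exact: ctsZ|exact: cts_cst].
  have F01 k x : 0 <= F k x <= 1.
    by rewrite /F le_min ge_min lexx le_max lexx ler01 !orbT.
  rewrite -(stateZ LS)//.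
  have -> : (fun x => n.+1%:R * f x) = (fun x => \sum_(k < n.+1) F k x).
    apply/funext => x; have /andP[fx0 fx1] := f01 x.
    by apply: layer_sum; [rewrite mulr_ge0|rewrite ler_piMr].
  rewrite (state_sum _ cF).2 -lee_fin -sumEFin big_ord_recl/=.
  pose A k := [set x | k.+1%:R < n.+1%:R * f x].
  have oA k : open (A k) by apply: open_gt; exact: ctsZ.
  apply: (@le_trans _ _ (1 + \sum_(k < n.+1) P (A k)))%E.
    apply: leeD.
      rewrite lee_fin -[leRHS](state1 LS); apply: (state_le LS) => //.
        exact: cts_cst.
      by move=> x; case/andP: (F01 0%N x).
    (* Splitting off the first slice left n terms against n + 1 level sets; the last level set is
       estimated by 0 from below. *)
    rewrite [leRHS]big_ord_recr/= -[leLHS]adde0; apply: leeD => //.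
    apply: lee_sum => k _; rewrite PE riesz_outer_open//; apply: rho_ge.
    split => // x /negP; rewrite /A /= -leNgt => fk.
    by rewrite /F max_r ?min_l// subr_le0.
  rewrite EFinD leeD2l// EFinM.
  rewrite /Rintegral fineK; last first.
    by apply: integrable_fin_num => //; exact: cts_integrable.
  apply: (@layer_cake_le _ _ _ P f) => //.
  exact: cts_measurable.
apply/ler_addgt0Pr => e e0.
have [n ne] : exists n : nat, e^-1 < n.+1%:R.
  exists (Num.truncn e^-1); exact: truncnS_gt.
have n0 : 0 < n.+1%:R :> R by rewrite ltr0n.
rewrite -(ler_pM2l n0) (le_trans (key n))// mulrDr addrC lerD2l.
by rewrite -ler_pdivrMr// div1r ltW.
Qed.

Theorem riesz : exists w : radon R X, forall f, continuous f -> rint w f = L f.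
Proof.
(* On an empty space the constants 0 and 1 would coincide, contrary to the normalisation of [L]. *)
have [x0 _] : exists x : X, True.
  apply: contrapT => X0; have := state1 LS.
  rewrite (_ : (fun=> 1) = (fun=> 0)) ?(state0 LS); last first.
    by apply/funext => x; exfalso; apply: X0; exists x.
  by move/eqP; rewrite eq_sym oner_eq0.
have [P PE] := riesz_probability LS hX x0.
have PC M : borel M -> P M = (1 - P (~` M))%E.
  move=> bM; rewrite probability_setC// oppeB ?fin_num_measure//.
  by rewrite addeA subee// add0e.
(* Inner regularity at M is the outer regularity built into [riesz_outer], taken at the complement
   of M. *)
have [|w [_ wP]] := @radon_of_probability R X hX x0 P.
  move=> M e bM e0.
  have [U [oU MU Ue]] := riesz_outer_adherent LS (~` M) e0.
  exists (~` U); split.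
  - by apply: closed_compactKH => //; exact: open_closedC.
  - by move=> x; apply: contra_notP => /MU.
  - have bU := borel_open oU; rewrite (PC _ bM).
    have -> : P (~` U) = (1 - P U)%E by exact: probability_setC.
    move: Ue; rewrite -(riesz_outer_open L oU) -PE.
    rewrite -[P U]fineK ?fin_num_measure//.
    rewrite -[P (~` M)]fineK; last by rewrite fin_num_measure//; exact: borel_setC.
    by rewrite -!EFinD !lee_fin; lra.
exists w => f cf; rewrite wP//; apply/esym.
exact: (state_eq hX LS (Rintegral_state hX P) (fun f => riesz_le PE)).
Qed.

End RieszTheorem.

(** * Radon measures and their weak topology *)

Section RadonMeasure.
Context {R : realType} {X : topologicalType}.
Implicit Types (f : X -> R) (w : radon R X) (M N : set X).
Hypothesis hX : compact_hausdorff X.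

Lemma borel_compact (K : set X) : compact K -> borel K.
Proof. by move=> cK; apply: borel_closed; exact: compact_closedKH. Qed.

Local Open Scope ereal_scope.

Lemma radon_le w M N : borel M -> borel N -> M `<=` N -> w M <= w N.
Proof.
move=> bM bN MN; rewrite !radon_probaE//.
by apply: le_measure => //; rewrite inE.
Qed.

Lemma radon_fin w M : borel M -> w M \is a fin_num.
Proof. by move=> bM; rewrite radon_probaE//; exact: fin_num_measure. Qed.

Lemma radon_ge0 w M : 0 <= w M.
Proof.
by have [bM|bM] := pselect (borel M); [rewrite radon_probaE|rewrite radon_out].
Qed.

Lemma radon_setC w M : borel M -> w (~` M) = 1 - w M.
Proof.
move=> bM; rewrite !radon_probaE//; last exact: borel_setC.
exact: probability_setC.
Qed.

Lemma radonT w : w setT = 1.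
Proof.
rewrite radon_probaE; last by apply: borel_open; exact: openT.
exact: probability_setT.
Qed.

Lemma radon_le1 w M : w M <= 1.
Proof.
have [bM|bM] := pselect (borel M); last by rewrite radon_out.
by rewrite -(radonT w); apply: radon_le => //; apply: borel_open; exact: openT.
Qed.

Lemma radon_inner w M (e : R) : borel M -> (0 < e)%R ->
  exists K, [/\ compact K, K `<=` M & w M <= w K + e%:E].
Proof.
move=> bM e0; have := radon_regular w bM; set S := [set _ | _ in _] => wM.
have [|_ [K [cK KM] <-] h] := @ub_ereal_sup_adherent R S e e0.
  by rewrite -wM radon_fin.
by exists K; split => //; rewrite -wM lteBlDr// in h; exact: ltW.
Qed.

Lemma radon_outer w M (e : R) : borel M -> (0 < e)%R ->
  exists U, [/\ open U, M `<=` U & w U <= w M + e%:E].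
Proof.
move=> bM e0; have [K [cK KM Ke]] := radon_inner w (borel_setC bM) e0.
have bK := borel_compact cK.
exists (~` K); split.
- by apply: closed_openC; exact: compact_closedKH.
- by move=> x Mx Kx; exact: KM Mx.
- move: Ke; rewrite !radon_setC// -[w M]fineK ?radon_fin// -[w K]fineK ?radon_fin//.
  by rewrite -!EFinD !lee_fin; lra.
Qed.

Lemma rint_integral w f : continuous f ->
  (rint w f)%:E = \int[radon_proba w]_x (f x)%:E.
Proof.
move=> cf; rewrite fineK//.
by apply: integrable_fin_num => //; exact: cts_integrable.
Qed.

Lemma rint_ge w M f : borel M -> continuous f -> (forall x, 0 <= f x)%R ->
  (forall x, M x -> 1 <= f x)%R -> w M <= (rint w f)%:E.
Proof.
move=> bM cf f0 f1; rewrite rint_integral// radon_probaE//.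
have <- : \int[radon_proba w]_x (\1_M x)%:E = radon_proba w M.
  by rewrite integral_indic// setIT.
apply: ge0_le_integral => //.
- by apply/measurable_EFinP; exact: measurable_indic.
- by apply/measurable_EFinP; exact: cts_measurable.
- move=> x _; rewrite lee_fin indicE; case: (boolP (x \in M)) => // /set_mem.
  exact: f1.
Qed.

Lemma rint_le w M f : borel M -> continuous f -> (forall x, 0 <= f x <= 1)%R ->
  (forall x, ~ M x -> f x = 0)%R -> (rint w f)%:E <= w M.
Proof.
move=> bM cf f01 f0; rewrite rint_integral// radon_probaE//.
have <- : \int[radon_proba w]_x (\1_M x)%:E = radon_proba w M.
  by rewrite integral_indic// setIT.
apply: ge0_le_integral => //.
- by move=> x _; rewrite lee_fin; case/andP: (f01 x).
- by apply/measurable_EFinP; exact: cts_measurable.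
- by apply/measurable_EFinP; exact: measurable_indic.
- move=> x _; rewrite lee_fin indicE; case: (boolP (x \in M)) => Mx.
    by case/andP: (f01 x).
  by rewrite f0//; move/negP: Mx; rewrite inE.
Qed.

(** A Urysohn function for a compact K inside an open U has an integral between the measure of K and
    that of U. Outer regularity then gives equality on compact sets, and inner regularity on all
    Borel sets; elsewhere both measures are 0. *)
Lemma rint_inj w w' : (forall f, continuous f -> rint w f = rint w' f) -> w = w'.
Proof.
have cle u v : (forall f, continuous f -> rint u f = rint v f) ->
    forall K, compact K -> u K <= v K.
  move=> uv K cK; apply/lee_addgt0Pr => e e0.
  have bK := borel_compact cK.
  have [U [oU KU Ue]] := radon_outer v bK e0.
  apply: le_trans Ue.
  have [|||f [cf f01 f1 f0]] := urysohnKH (R := R) hX (A := K) (B := ~` U).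
  - exact: compact_closedKH.
  - exact: open_closedC.
  - by apply/seteqP; split => x //= [/KU].
  apply: (@le_trans _ _ (rint u f)%:E).
    apply: rint_ge => // [x|x Kx]; first by case/andP: (f01 x).
    by rewrite f1.
  by rewrite uv//; apply: rint_le => //; exact: borel_open.
move=> ww'; have wE : radon_val w = radon_val w'.
  apply/funext => M; have [bM|bM] := pselect (borel M); last by rewrite !radon_out.
  rewrite !radon_regular//; congr ereal_sup; apply/seteqP.
  have eqK K : compact K -> w K = w' K.
    move=> cK; apply/eqP; rewrite eq_le !cle// => f cf.
    by rewrite ww'.
  by split => _ [K [cK KM] <-]; exists K => //; rewrite eqK.
case: w w' {ww' cle} wE => [w wP] [w' w'P] /= ww'; subst w'.
by congr MkRadon; exact: Prop_irrelevance.
Qed.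

End RadonMeasure.

(** * The weak topology and its compactness *)

Section RadonSpace.
Context {R : realType} {X : topologicalType}.
Implicit Types (f : X -> R).
Hypothesis hX : compact_hausdorff X.

Lemma rint_continuous f : continuous f ->
  continuous (fun w : radon R X => rint w f).
Proof.
move=> cf w.
have /cvg_sup /(_ (exist _ f cf)) h : nbhs w --> (w : radon_weak_topology R X).
  exact: cvg_id.
apply: cvg_trans (@initial_continuous (radon R X) R
  (fun w : radon R X => rint w f) w).
exact: (cvg_app _ h).
Qed.

Lemma cvg_radon (F : set_system (radon R X)) (w : radon R X) : Filter F ->
  (forall f, continuous f -> rint v f @[v --> F] --> rint w f) -> F --> w.
Proof.
move=> FF H; apply/(@cvg_sup _ _ _ F w) => -[f cf] A.
move=> [_ [[B oB <-] Bw] BA]; apply: filterS BA _.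
by apply: (H f cf); exact: open_nbhs_nbhs.
Qed.

(** Along an ultrafilter the integrals of each continuous function stay in a segment and converge.
    The limits form a state, whose Riesz measure is the limit of the ultrafilter. *)
Lemma radon_compact : compact [set: radon R X].
Proof.
rewrite compact_ultra => F FU _.
have cvgF f : continuous f -> exists l : R, rint v f @[v --> F] --> l.
  move=> cf; have [M M0 fM] := cts_bounded hX cf.
  have [|l [_ lP]] := @segment_compact R (- M) M (rint v f @[v --> F]) _;
    last first.
    (* For an ultrafilter a cluster point is a limit: otherwise the complement of a neighbourhood
       would be in the filter. *)
    exists l => A lA; have [//|FA] := in_ultra_setVsetC ((rint^~ f) @^-1` A) FU.
    by have [z []] := lP (~` A) A FA lA.
  apply: (@filterE _ F _ ((rint^~ f) @^-1` _)) => v; rewrite /= in_itv/=.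
  have cM : continuous (fun _ : X => M) by exact: cts_cst.
  have cM' : continuous (fun _ : X => - M) by exact: cts_cst.
  have S := rint_state hX v.
  rewrite -{1}(state_cst S (- M)) -{2}(state_cst S M); apply/andP; split;
    by apply: (state_le S) => // x; have := fM x; rewrite ler_norml => /andP[].
(* The limit functional, with the default value 0 at discontinuous functions, where a state is
   unconstrained. *)
pose L f :=
  if pselect (continuous f) is left cf then projT1 (cid (cvgF f cf)) else 0.
have LP f : continuous f -> rint v f @[v --> F] --> L f.
  by rewrite /L; case: pselect => // cf _; case: cid.
have Lu f l : continuous f -> rint v f @[v --> F] --> l -> L f = l.
  by move=> cf h; apply: cvg_unique h; [exact: Rhausdorff|exact: LP].
have LS : is_state L.
  split => [a f g cf cg|f cf f0|].
  - apply: Lu; first by apply: ctsD => //; exact: ctsZ.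
    rewrite (_ : (fun v => _) = fun v => a * rint v f + rint v g).
      by apply: cvgD; [apply: cvgM; [exact: cvg_cst|exact: LP]|exact: LP].
    by apply/funext => v; rewrite (state_linear (rint_state hX v)).
  - rewrite -(cvg_lim _ (LP f cf)); last exact: Rhausdorff.
    apply: limr_ge; first by apply/cvg_ex; exists (L f); exact: LP.
    by apply: filterE => v; apply: (state_ge0 (rint_state hX v)).
  - apply: Lu; first exact: cts_cst.
    rewrite (_ : (fun v => _) = fun=> 1); first exact: cvg_cst.
    by apply/funext => v; rewrite (state1 (rint_state hX v)).
have [w wL] := riesz hX LS.
exists w; split => //=; apply: cvg_radon => f cf.
by rewrite wL//; exact: LP.
Qed.

Lemma radon_compact_hausdorff : compact_hausdorff (radon R X).
Proof.
split; first exact: radon_compact.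
apply: (@hausdorff_separate R _ [set h | exists2 f, continuous f &
   h = fun w => rint w f]).
  by move=> _ [f cf ->]; exact: rint_continuous.
move=> v w vw; apply: (rint_inj hX) => f cf.
by have := vw (fun w => rint w f); apply; exists f.
Qed.

End RadonSpace.

(** * Induction on Borel sets *)

Section BorelInduction.
Context {R : realType} {X : topologicalType}.

Lemma borel_bigcup (F : (set X)^nat) : (forall n, borel (F n)) ->
  borel (\bigcup_n F n).
Proof. by have [_ _ +] := smallest_sigma_algebra [set: X] (@open X); apply. Qed.

(** The pi-lambda theorem for the open sets, which generate the Borel sets and are closed under
    finite intersections. *)
Lemma borel_induction (x0 : X) (C : set X -> Prop) :
  (forall U, open U -> C U) ->
  (forall M, borel M -> C M -> C (~` M)) ->
  (forall F : (set X)^nat, (forall n, borel (F n)) -> trivIset [set: nat] F ->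
    (forall n, C (F n)) -> C (\bigcup_n F n)) ->
  forall M, borel M -> C M.
Proof.
move=> CU CC CF M bM.
apply: (@dynkin_induction _ (borelType x0) (@open X) C) => //.
- by move=> A B; exact: openI.
- by apply: CU; exact: openT.
Qed.

Lemma radon_bigcup (w : radon R X) (F : (set X)^nat) :
  (forall n, borel (F n)) -> trivIset [set: nat] F ->
  w (\bigcup_n F n) = (\sum_(n <oo) w (F n))%E.
Proof.
move=> bF tF; have bU := borel_bigcup bF.
rewrite radon_probaE// (@measure_semi_bigcup _ _ (borelType (radon_point w))
  (radon_proba w) F)//.
by apply: eq_eseriesr => n _; rewrite radon_probaE.
Qed.

End BorelInduction.

(** * Radon measures obtained from states *)

Section RadonOf.
Context {R : realType} {X : topologicalType}.
Implicit Types (f : X -> R) (w : radon R X).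
Hypothesis hX : compact_hausdorff X.

Definition state_radon (L : (X -> R) -> R) (LS : is_state L) : radon R X :=
  projT1 (cid (riesz hX LS)).

Lemma rint_state_radon L (LS : is_state L) f : continuous f ->
  rint (state_radon LS) f = L f.
Proof. by rewrite /state_radon; case: cid => w /= wL; exact: wL. Qed.

(** Serves to compute a measure given by a functional on Borel sets: it is enough to exhibit an
    inner regular probability with the same integrals. *)
Lemma radon_unique (x0 : X) (P : probability (borelType x0) R) w :
  (forall (M : set X) (e : R), borel M -> (0 < e)%R ->
     exists K, [/\ compact K, K `<=` M & P M <= P K + e%:E])%E ->
  (forall f, continuous f -> rint w f = \int[P]_x f x) ->
  forall M, borel M -> w M = P M.
Proof.
move=> /(radon_of_probability hX)[v [vM vf]] wf M bM.
rewrite -vM//; congr (radon_val _ M); apply: (rint_inj hX) => f cf.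
by rewrite wf// vf.
Qed.

Lemma dirac_state (x : X) : is_state (fun f => f x).
Proof. by split. Qed.

Definition radon_dirac (x : X) : radon R X := state_radon (dirac_state x).

Lemma radon_diracE (x : X) (B : set X) : borel B ->
  radon_dirac x B = (\d_(x : borelType x) B)%E.
Proof.
pose P : probability (borelType x) R := \d_(x : borelType x).
have PE (A : set X) : P A = ((x \in A)%:R)%:E by exact: diracE.
apply: (@radon_unique x P) => [M e bM e0|f cf].
  have [Mx|Mx] := pselect (M x).
    exists [set x]; split.
    - by apply: compact_set1.
    - by move=> _ ->.
    - by rewrite !PE !mem_set//= -[leLHS]adde0 leeD2l// lee_fin ltW.
  exists set0; split => //; first exact: compact0.
  by rewrite PE memNset// measure0 add0e lee_fin ltW.
rewrite rint_state_radon// /Rintegral integral_dirac//; last first.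
  by apply/measurable_EFinP; exact: cts_measurable.
by rewrite diracT mul1e.
Qed.

End RadonOf.

(** * Pushforward of Radon measures *)

Section RadonMap.
Context {R : realType} {X Y : topologicalType}.
Hypotheses (hX : compact_hausdorff X) (hY : compact_hausdorff Y).
Variable a : X -> Y.
Hypothesis ca : continuous a.

Lemma cts_comp (f : Y -> R) : continuous f -> continuous (f \o a).
Proof. by move=> cf x; apply: continuous_comp; [exact: ca|exact: cf]. Qed.

Lemma map_state (w : radon R X) : is_state (fun f : Y -> R => rint w (f \o a)).
Proof.
have S := rint_state hX w; split => [b f g cf cg|f cf f0|].
- by rewrite -(state_linear S)//; exact: cts_comp.
- by apply: (state_ge0 S) => [|x]; [exact: cts_comp|exact: f0].
- exact: (state1 S).
Qed.

Definition radon_map (w : radon R X) : radon R Y := state_radon hY (map_state w).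

Lemma rint_map (w : radon R X) f : continuous f ->
  rint (radon_map w) f = rint w (f \o a).
Proof. exact: rint_state_radon. Qed.

Lemma borel_preimage (B : set Y) : borel B -> borel (a @^-1` B).
Proof.
suff: @borel Y `<=` [set M | borel (a @^-1` M)] by apply.
apply: smallest_sub; last first.
  by move=> U oU; apply: borel_open; apply: open_comp => // x _; exact: ca.
have [b0 bC bU] := smallest_sigma_algebra [set: X] (@open X).
split.
- by rewrite /= preimage_set0.
- by move=> A bA; rewrite /= setTD preimage_setC; exact: borel_setC.
- by move=> F bF; rewrite /= preimage_bigcup; exact: bU.
Qed.

(** The set function on the right is a probability on Y. It is inner regular because the image of a
    compact K is compact with preimage containing K, and its integrals are given by change of
    variables. *)
Lemma radon_mapE (w : radon R X) (B : set Y) : borel B ->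
  radon_map w B = w (a @^-1` B).
Proof.
move=> bB; rewrite [RHS]radon_probaE; last exact: borel_preimage.
pose x0 := radon_point w; pose y0 : Y := a x0; set P := radon_proba w.
have ma : measurable_fun [set: borelType x0] (a : borelType x0 -> borelType y0).
  by move=> _ M mM; rewrite setTI; exact: borel_preimage.
have [||||Q QE] := @exists_probability _ (borelType y0) R (fun M => P (a @^-1` M)).
- by rewrite preimage_set0 measure0.
- by [].
- move=> F mF tF mUF; rewrite preimage_bigcup.
  apply: (@measure_semi_sigma_additive _ _ _ P).
  + by move=> n; exact: (borel_preimage (mF n)).
  + by move=> i j _ _ [x [Fi Fj]]; apply: tF => //; exists (a x).
  + by rewrite -preimage_bigcup; exact: (borel_preimage mUF).
- by rewrite preimage_setT; exact: probability_setT.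
rewrite -[RHS](congr1 (fun m => m B) QE).
apply: (radon_unique hY) bB => [M e bM e0|f cf].
  have [K [cK KM Ke]] := radon_inner w (borel_preimage bM) e0.
  have bK := borel_compact hX cK.
  have caK : compact (a @` K).
    by apply: continuous_compact => //; exact: continuous_subspaceT.
  exists (a @` K); split => //.
    by move=> _ [x Kx <-]; exact: KM.
  rewrite QE -!radon_probaE//; last 2 first.
  - by apply: borel_preimage; exact: borel_compact.
  - exact: borel_preimage.
  apply: (le_trans Ke); rewrite leeD2r//; apply: radon_le => //.
    by apply: borel_preimage; exact: borel_compact.
  by move=> x Kx; exists x.
rewrite rint_map//.
apply: (state_eq hY (map_state w) (Rintegral_state hY Q) _ cf) => g cg g01.
rewrite /Rintegral.
(* [Q] agrees on Borel sets with the pushforward measure, for which the change of variables formula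
   is available. *)
have <- : (\int[@pushforward _ _ (borelType x0) (borelType y0) R P a]_y
    (g y)%:E = \int[Q]_y (g y)%:E)%E.
  by apply: eq_measure_integral => M mM _; exact: esym (congr1 (fun m => m M) QE).
rewrite (@ge0_integral_pushforward _ _ (borelType x0) (borelType y0) R a ma P)//.
- by apply/measurable_EFinP; exact: cts_measurable.
- by move=> y _; rewrite lee_fin; case/andP: (g01 y).
Qed.

End RadonMap.

(** * Barycenters *)

Section OpenApprox.
Context {R : realType} {X : topologicalType}.
Implicit Types (f : X -> R) (w : radon R X).
Hypothesis hX : compact_hausdorff X.

Lemma radon_open_approx w (U : set X) (e : R) : open U -> 0 < e ->
  exists2 f, below U f & (w U <= (rint w f)%:E + e%:E)%E.
Proof.
move=> oU e0; have [K [cK KU Ke]] := radon_inner w (borel_open oU) e0.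
have [|||f [cf f01 f1 f0]] := urysohnKH (R := R) hX (A := K) (B := ~` U).
- exact: compact_closedKH.
- exact: open_closedC.
- by apply/seteqP; split => x //= [/KU].
exists f; first by split.
apply: (le_trans Ke); rewrite leeD2r//; apply: rint_ge => //.
- exact: borel_compact.
- by move=> x; case/andP: (f01 x).
- by move=> x Kx; rewrite f1.
Qed.

Lemma rint_below w (U : set X) f : open U -> below U f ->
  ((rint w f)%:E <= w U)%E.
Proof. by move=> oU [cf f01 f0]; apply: rint_le => //; exact: borel_open. Qed.

Lemma radon_open_gt (U : set X) (w : radon R X) (a : R) : open U ->
  (a%:E < w U)%E -> exists2 f, below U f & a < rint w f.
Proof.
move=> oU; have wU := radon_fin w (borel_open oU).
rewrite -(fineK wU) lte_fin => aw.
have [|f fU wf] := @radon_open_approx w U ((fine (w U) - a) / 2) oU.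
  by rewrite divr_gt0// subr_gt0.
exists f => //; move: wf; rewrite -(fineK wU) -EFinD lee_fin; lra.
Qed.

(** The map taking w to w U is the supremum of the continuous maps [rint^~ f] over f below U, hence
    lower semicontinuous. *)
Lemma radon_lsc (U : set X) (a : R) : open U ->
  open [set w : radon R X | (a%:E < w U)%E].
Proof.
move=> oU; rewrite (_ : [set _ | _] =
    \bigcup_(f in below U) [set w : radon R X | a < rint w f]).
  apply: bigcup_open => f [cf _ _]; apply: open_gt; exact: rint_continuous.
apply/seteqP; split => w /=.
  by move=> /(radon_open_gt oU)[f fU af]; exists f.
move=> [f fU /= af]; apply: lt_le_trans (rint_below w oU fU).
by rewrite lte_fin.
Qed.

Lemma below_max (U : set X) f g : below U f -> below U g ->
  below U (fun x => Num.max (f x) (g x)).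
Proof.
move=> [cf f01 f0] [cg g01 g0]; split; first exact: cts_max.
- move=> x; rewrite le_max ge_max.
  by have /andP[-> ->] := f01 x; have /andP[_ ->] := g01 x.
- by move=> x Ux; rewrite f0// g0// maxxx.
Qed.

Lemma rint_mono w f g : continuous f -> continuous g ->
  (forall x, f x <= g x) -> rint w f <= rint w g.
Proof. exact: (state_le (rint_state hX w)). Qed.

(* The open sets [{w | a < rint w f}], [f] below [U], form a directed cover. *)
Lemma compact_below (U : set X) (a : R) (C : set (radon R X)) : open U ->
  compact C -> (forall w, C w -> (a%:E < w U)%E) ->
  exists2 f, below U f & forall w, C w -> a < rint w f.
Proof.
move=> oU /compact_near_coveringP cC CU.
(* The filter of tails of the directed set of functions below U; with it, compactness yields a
   single f in place of a finite subcover. *)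
pose F := filter_from (below (R := R) U)
  (fun f => [set g | below U g /\ forall x, f x <= g x]).
have FF : Filter F.
  apply: filter_from_filter; first by exists (fun=> 0); exact: below0.
  move=> f g fU gU; exists (fun x => Num.max (f x) (g x)); first exact: below_max.
  move=> h [hU hfg]; split; split => // x; apply: le_trans (hfg x);
    by rewrite le_max lexx ?orbT.
have [|f fU /(_ f) fC] := cC _ F (fun f w => a < rint w f) FF.
  move=> w /CU /(radon_open_gt oU)[f fU af].
  exists ([set v | a < rint v f], [set g | below U g /\ forall x, f x <= g x]).
    split => /=; last by exists f.
    apply: open_nbhs_nbhs; split => //; apply: open_gt.
    by apply: rint_continuous => //; case: fU.
  move=> [v g] /= [av [gU fg]]; apply: (lt_le_trans av).
  by apply: rint_mono => //; [case: fU|case: gU].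
by exists f => // w Cw; apply: fC.
Qed.

(** Merges the functions found for finitely many level sets into a single one. *)
Lemma below_bound (U : set X) (F : nat -> X -> R) n :
  (forall k, below U (F k)) ->
  exists2 f, below U f & forall k x, (k < n)%N -> F k x <= f x.
Proof.
move=> FU; elim: n => [|n [f fU Ff]].
  by exists (fun=> 0) => //; exact: below0.
exists (fun x => Num.max (f x) (F n x)); first exact: below_max.
move=> k x; rewrite ltnS leq_eqVlt => /orP[/eqP ->|kn].
  by rewrite le_max lexx orbT.
by rewrite le_max Ff.
Qed.

End OpenApprox.

Section Barycenter.
Context {R : realType} {X : topologicalType}.
Implicit Types (f : X -> R) (B M U : set X).
Hypothesis hX : compact_hausdorff X.
Variable W : radon R (radon R X).

Let hRX := radon_compact_hausdorff (R := R) hX.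
Let T := borelType (radon_point W).

Lemma barycenter_state : is_state (fun f => rint W (fun t => rint t f)).
Proof.
have S := rint_state hRX W; split => [a f g cf cg|f cf f0|].
- rewrite -(state_linear S); [|exact: rint_continuous|exact: rint_continuous].
  by congr rint; apply/funext => t; rewrite (state_linear (rint_state hX t)).
- apply: (state_ge0 S) => [|t]; first exact: rint_continuous.
  exact: (state_ge0 (rint_state hX t)).
- rewrite -[RHS](state1 S); congr rint; apply/funext => t.
  by rewrite (state1 (rint_state hX t)).
Qed.

Definition barycenter : radon R X := state_radon hX barycenter_state.

Lemma rint_barycenter f : continuous f ->
  rint barycenter f = rint W (fun t => rint t f).
Proof. exact: rint_state_radon. Qed.

Local Open Scope ereal_scope.

Let x0 : X := radon_point (radon_point W).

(** Lower semicontinuity settles open sets; complements and disjoint unions follow by pi-lambda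
    induction. *)
Lemma measurable_radon_eval B : borel B ->
  measurable_fun [set: T] (fun t : T => (t : radon R X) B).
Proof.
move: B; apply: (borel_induction x0) => [U oU|M bM mM|F bF tF mF].
- have -> : (fun t : T => (t : radon R X) U) =
      EFin \o (fun t : T => fine ((t : radon R X) U)).
    by apply/funext => t /=; rewrite fineK// radon_fin//; exact: borel_open.
  apply/measurable_EFinP; apply: (measurability (@RGenOInfty.G R)).
    exact: RGenOInfty.measurableE.
  move=> _ [_ [a ->] <-]; rewrite setTI; apply: borel_open.
  rewrite (_ : _ @^-1` _ = [set w : radon R X | a%:E < w U]).
    exact: radon_lsc.
  apply/seteqP; split => t /=; rewrite in_itv/= andbT -lte_fin fineK//;
    by apply: radon_fin => //; exact: borel_open.
- rewrite (_ : (fun _ => _) = (fun t : T => cst 1 t - (t : radon R X) M)).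
    by apply: emeasurable_funB.
  by apply/funext => t; rewrite radon_setC.
- rewrite (_ : (fun _ => _) = (fun t : T => \sum_(n <oo) (t : radon R X) (F n))).
    apply: ge0_emeasurable_sum => // n t _ _; exact: radon_ge0.
  by apply/funext => t; rewrite radon_bigcup.
Qed.

(** One inequality integrates [rint t f <= t U] for f below U. For the other, the level sets of t U
    are open and are exhausted by compact sets up to 1 / (n + 1); on these a single f below U passes
    the same levels, and the layer-cake estimates compare the integrals of t U and of [rint t f]. *)
Lemma barycenter_open U : open U -> barycenter U = radon_integral W (fun t => t U).
Proof.
move=> oU; have bU := borel_open oU.
have i0 : 0 <= radon_integral W (fun t => t U).
  by apply: integral_ge0 => t _; exact: radon_ge0.
have i_fin : radon_integral W (fun t => t U) \is a fin_num.
  rewrite ge0_fin_numE//; apply: (@le_lt_trans _ _ 1); last exact: ltry.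
  have <- : \int[radon_proba W]_x (cst 1 x) = 1.
    by rewrite integral_cst// [X in _ * X]probability_setT mule1.
  apply: ge0_le_integral => //.
  - by move=> t _; exact: radon_ge0.
  - exact: measurable_radon_eval.
  - by move=> t _; exact: radon_le1.
apply/eqP; rewrite eq_le; apply/andP; split.
  apply/lee_addgt0Pr => e e0.
  have [f fU Uf] := radon_open_approx hX barycenter oU e0.
  have [cf f01 _] := fU.
  apply: (le_trans Uf); rewrite leeD2r// rint_barycenter//.
  rewrite (rint_integral hRX); last exact: rint_continuous.
  apply: ge0_le_integral => //.
  - move=> t _; rewrite lee_fin; apply: (state_ge0 (rint_state hX t)) => // x.
    by case/andP: (f01 x).
  - apply/measurable_EFinP; apply: (cts_measurable (x0 := radon_point W)).
    exact: rint_continuous.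
  - exact: measurable_radon_eval.
  - by move=> t _; exact: rint_below.
(* One unit is the rounding error of [layer_cake_ge]; the other is the sum of n + 1 losses of size 1
   / (n + 1) from inner regularity. *)
have key n : n.+1%:R%:E * radon_integral W (fun t => t U) <=
    1 + 1 + n.+1%:R%:E * barycenter U.
  pose e : R := (n.+1%:R)^-1%R.
  have e0 : (0 < e)%R by rewrite invr_gt0 ltr0n.
  pose s (t : T) : R := fine ((t : radon R X) U).
  have sE (t : T) : (s t)%:E = (t : radon R X) U by rewrite fineK// radon_fin.
  pose O k := [set t : radon R X | (k.+1%:R < n.+1%:R * s t)%R].
  have OE k : O k = [set t : radon R X | (k.+1%:R / n.+1%:R)%:E < t U].
    apply/seteqP; split => t; rewrite /O /= -sE lte_fin ltr_pdivrMr ?ltr0n//;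
      by rewrite mulrC.
  have oO k : open (O k) by rewrite OE; exact: radon_lsc.
  have bO k := borel_open (oO k).
  have /choice[C CP] : forall k, exists C, [/\ compact C, C `<=` O k &
      W (O k) <= W C + e%:E].
    by move=> k; exact: radon_inner.
  have /choice[F FP] : forall k, exists f, below U f /\
      forall t, C k t -> (k.+1%:R / n.+1%:R < rint t f)%R.
    move=> k; have [cC CO _] := CP k.
    have [|f fU fC] := compact_below hX oU cC (a := (k.+1%:R / n.+1%:R)%R).
      by move=> t /CO; rewrite OE.
    by exists f.
  have [f fU Ff] := @below_bound R X U F n.+1 (fun k => (FP k).1).
  have [cf f01 _] := fU.
  have cr : continuous (fun t : radon R X => rint t f) by exact: rint_continuous.
  (* The level sets for the common function f; they contain the compact sets [C k] with k <= n. *)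
  pose D k := [set t : radon R X | (k.+1%:R < n.+1%:R * rint t f)%R].
  have bD k : borel (D k).
    by apply: borel_open; apply: open_gt; exact: ctsZ.
  have CD k : (k < n.+1)%N -> C k `<=` D k.
    move=> kn t Ct; have := (FP k).2 t Ct; rewrite ltr_pdivrMr ?ltr0n// mulrC /D /=.
    move=> /lt_le_trans; apply; rewrite ler_pM2l ?ltr0n//.
    by apply: rint_mono => //; [case: (FP k).1|move=> x; exact: Ff].
  have r01 t : (0 <= rint t f <= 1)%R.
    have S := rint_state hX t; rewrite (state_ge0 S)//=; last first.
      by move=> x; case/andP: (f01 x).
    rewrite -[leRHS](state1 S); apply: (state_le S) => //; first exact: cts_cst.
    by move=> x; case/andP: (f01 x).
  have s01 t : (0 <= s t <= 1)%R.
    by rewrite -!lee_fin sE radon_ge0 radon_le1.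
  have ms : measurable_fun [set: T] s.
    apply/measurable_EFinP; rewrite (_ : _ \o _ = (fun t : T => (t : radon R X) U)).
      exact: measurable_radon_eval.
    by apply/funext => t /=; exact: sE.
  apply: (@le_trans _ _ (1 + \sum_(k < n.+1) W (O k))).
    have := layer_cake_ge (radon_proba W) ms s01 n.+1.
    under eq_integral do rewrite sE.
    move=> /le_trans; apply; rewrite leeD2l//; apply: lee_sum => k _.
    by rewrite (radon_probaE _ (bO k)).
  rewrite -addeA leeD2l//.
  apply: (@le_trans _ _ (\sum_(k < n.+1) (W (D k) + e%:E))).
    apply: lee_sum => k _; have [cC CO Ce] := CP k.
    apply: (le_trans Ce); rewrite leeD2r//; apply: radon_le => //.
      exact: (borel_compact hRX).
    exact: CD.
  rewrite big_split/= addeC; apply: leeD.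
    by rewrite sumEFin sumr_const card_ord lee_fin -mulr_natl /e mulfV.
  apply: (@le_trans _ _ (n.+1%:R%:E * (rint barycenter f)%:E)); last first.
    by apply: lee_wpmul2l => //; exact: rint_below.
  rewrite rint_barycenter// (rint_integral hRX _ cr).
  under eq_bigr do rewrite (radon_probaE _ (bD _)).
  apply: (@layer_cake_le _ _ _ (radon_proba W) (fun t => rint t f)) => //.
  exact: (cts_measurable (x0 := radon_point W)).
have bf : barycenter U \is a fin_num by exact: radon_fin.
rewrite -(fineK i_fin) -(fineK bf) lee_fin.
apply/ler_addgt0Pr => e e0.
have [n ne] : exists n : nat, (2 / e < n.+1%:R)%R.
  exists (Num.truncn (2 / e)); exact: truncnS_gt.
have n0 : (0 < n.+1%:R :> R)%R by rewrite ltr0n.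
have := key n; rewrite -(fineK i_fin) -(fineK bf) -!EFinM -!EFinD lee_fin => h.
rewrite -(ler_pM2l n0) (le_trans h)// mulrDr addrC lerD2l.
by rewrite -ler_pdivrMr// ltW.
Qed.

(** Pi-lambda induction from the open sets: complements by integrating the fact that the measures of
    M and its complement add up to 1, disjoint unions by exchanging sum and integral. *)
Lemma barycenterE B : borel B -> barycenter B = radon_integral W (fun t => t B).
Proof.
move: B; apply: (borel_induction x0) => [U oU|M bM IH|F bF tF IH].
- exact: barycenter_open.
- have : radon_integral W (fun t => t M) + radon_integral W (fun t => t (~` M)) = 1.
    rewrite -[LHS]ge0_integralD//.
    + have <- : \int[radon_proba W]_x (cst 1 x) = 1.
        by rewrite integral_cst// [X in _ * X]probability_setT mule1.
      apply: eq_integral => t _.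
      have := radon_fin t bM; rewrite radon_setC//.
      by case: (t M) => // a _; rewrite -EFinB -EFinD addrC subrK.
    + by move=> t _; exact: radon_ge0.
    + exact: measurable_radon_eval.
    + by move=> t _; exact: radon_ge0.
    + by apply: measurable_radon_eval; exact: borel_setC.
  rewrite -IH radon_setC// => h.
  have := radon_fin barycenter bM; case: (barycenter M) h => // a h _.
  by rewrite -h addeAC subee// add0e.
- rewrite radon_bigcup//; under eq_eseriesr do rewrite IH.
  rewrite /radon_integral -integral_nneseries//; last 2 first.
  + by move=> n; exact: measurable_radon_eval.
  + by move=> n t _; exact: radon_ge0.
  by apply: eq_integral => t _; rewrite radon_bigcup.
Qed.

End Barycenter.

(** * The join monoidal structure *)

Section TestFamily.
Context {R : realType}.

(** Constants are included because [jpair_separate] evaluates at 0 and 1; with them, test families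
    of two spaces give one for their join. *)
Record test_family (X : topologicalType) (Phi : set (X -> R)) : Prop :=
  TestFamily {
  test_continuous : forall f, Phi f -> continuous f;
  test_cst : forall c, Phi (fun=> c);
  test_separate : forall x y, (forall f, Phi f -> f x = f y) -> x = y }.

Lemma test_cts (X : topologicalType) : compact_hausdorff X ->
  test_family [set f : X -> R | continuous f].
Proof.
by move=> hX; split => [//|c|x y]; [exact: cts_cst|exact: cts_separate].
Qed.

Definition jtest (X Y : topologicalType) (Phi : set (X -> R))
    (Psi : set (Y -> R)) : set (join R X Y -> R) :=
  [set h | exists f g, [/\ Phi f, Psi g & h = jpair f g]].

Lemma test_join (X Y : topologicalType) (Phi : set (X -> R))
    (Psi : set (Y -> R)) : compact_hausdorff X -> compact_hausdorff Y ->
  test_family Phi -> test_family Psi -> test_family (jtest Phi Psi).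
Proof.
move=> hX hY [cP kP sP] [cQ kQ sQ]; split.
- by move=> _ [f [g [Pf Qg ->]]]; apply: jpair_continuous; [| |exact: cP|exact: cQ].
- move=> c; exists (fun=> c), (fun=> c); split => //.
  by apply/funext => p; rewrite jpair_cst.
- move=> p q pq; apply: (jpair_separate kP kQ sP sQ) => f g Pf Qg.
  by apply: pq; exists f, g.
Qed.

Lemma test_radon (X : topologicalType) : compact_hausdorff X ->
  test_family [set h : radon R X -> R | exists2 f, continuous f & h = rint^~ f].
Proof.
move=> hX; split.
- by move=> _ [f cf ->]; exact: rint_continuous.
- move=> c; exists (fun=> c); first exact: cts_cst.
  by apply/funext => w; rewrite (state_cst (rint_state hX w)).
- move=> v w vw; apply: (rint_inj hX) => f cf.
  by apply: (vw (rint^~ f)); exists f.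
Qed.

Lemma cts_test (Z K : topologicalType) (h : Z -> K) (Phi : set (K -> R)) :
  compact_hausdorff K -> test_family Phi ->
  (forall f, Phi f -> continuous (f \o h)) -> continuous h.
Proof. by move=> hK [cP _ sP]; exact: cts_by_separate. Qed.

End TestFamily.

Section JoinAssocInverse.
Context {R : realType} {X Y Z : Type}.

(* Reversing all factors exchanges the two bracketings. *)
Definition join_associ (p : join R X (join R Y Z)) : join R (join R X Y) Z :=
  join_map (@join_symm R Y X) idfun (join_symm (join_assoc
    (join_map (@join_symm R Y Z) idfun (join_symm p)))).

Lemma jpair_join_associ (f : X -> R) (g : Y -> R) (h : Z -> R) p :
  jpair (jpair f g) h (join_associ p) = jpair f (jpair g h) p.
Proof.
rewrite /join_associ jpair_join_map jpair_join_symm.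
rewrite (_ : jpair f g \o _ = jpair g f); last first.
  by apply/funext => q; exact: jpair_join_symm.
rewrite jpair_join_assoc jpair_join_map.
rewrite (_ : jpair h g \o _ = jpair g h); last first.
  by apply/funext => q; exact: jpair_join_symm.
exact: jpair_join_symm.
Qed.

End JoinAssocInverse.

Local Notation hom := Defs.hom.
Local Notation EM := Defs.EM.
Local Open Scope cat_scope.

Section JoinMonoidal.
Variable R : realType.

Lemma KHjoin_prop (X Y : KHspace) : compact_hausdorff (join R X Y).
Proof. by apply: join_compact_hausdorff; exact: KH_prop. Qed.

Local Notation jn := (KHjoin KHjoin_prop).
Local Notation cts X := ([set f : X -> R | continuous f]).
Implicit Types X Y Z : KH.

Lemma KH_eq X Y (f g : hom X Y) : (forall x, f x = g x) -> f = g.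
Proof. by move=> fg; apply/continuousEP. Qed.

Lemma KH_cts X Y (f : hom X Y) : continuous f.
Proof. exact: cts_fun. Qed.

Lemma KH_eq_test X Y (Phi : set (Y -> R)) (f g : hom X Y) : test_family Phi ->
  (forall h x, Phi h -> h (f x) = h (g x)) -> f = g.
Proof.
move=> PT fg; apply: KH_eq => x; apply: (test_separate PT) => h Ph.
exact: fg.
Qed.

Lemma test_KH X : test_family (cts X).
Proof. by apply: test_cts; exact: KH_prop. Qed.

Lemma test_KHjoin X Y (Phi : set (X -> R)) (Psi : set (Y -> R)) :
  test_family Phi -> test_family Psi ->
  test_family (jtest Phi Psi : set (jn X Y -> R)).
Proof. by apply: test_join; exact: KH_prop. Qed.

Lemma jpair_cts X Y (f : X -> R) (g : Y -> R) : continuous f -> continuous g ->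
  continuous (jpair f g : jn X Y -> R).
Proof. by apply: jpair_continuous; exact: KH_prop. Qed.

Lemma join_map_cts X X' Y Y' (f : hom X X') (g : hom Y Y') :
  continuous (join_map f g : jn X Y -> jn X' Y').
Proof.
apply: (cts_test (KH_prop (jn X' Y')) (test_KHjoin (test_KH X') (test_KH Y'))).
move=> _ [a [b [ca cb ->]]].
rewrite (_ : _ \o _ = jpair (a \o f) (b \o g)).
  by apply: jpair_cts; apply: cts_comp => //; exact: KH_cts.
by apply/funext => p; exact: jpair_join_map.
Qed.

Lemma join_symm_cts X Y : continuous (@join_symm R X Y : jn X Y -> jn Y X).
Proof.
apply: (cts_test (KH_prop (jn Y X)) (test_KHjoin (test_KH Y) (test_KH X))).
move=> _ [a [b [ca cb ->]]].
rewrite (_ : _ \o _ = jpair b a); first exact: jpair_cts.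
by apply/funext => p; exact: jpair_join_symm.
Qed.

Lemma test_assoc X Y Z :
  test_family (jtest (cts X) (jtest (cts Y) (cts Z)) : set (jn X (jn Y Z) -> R)).
Proof. by do 2?apply: test_KHjoin; exact: test_KH. Qed.

Lemma join_assoc_cts X Y Z :
  continuous (@join_assoc R X Y Z : jn (jn X Y) Z -> jn X (jn Y Z)).
Proof.
apply: (cts_test (KH_prop (jn X (jn Y Z))) (@test_assoc X Y Z)).
move=> _ [a [_ [ca [b [c [cb cc ->]]] ->]]].
rewrite (_ : _ \o _ = jpair (jpair a b) c).
  by apply: (@jpair_cts (jn X Y) Z) => //; exact: jpair_cts.
by apply/funext => p; exact: jpair_join_assoc.
Qed.

Definition KHmap X X' Y Y' (f : hom X X') (g : hom Y Y') :
    hom (jn X Y) (jn X' Y') :=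
  mkcts (@join_map_cts X X' Y Y' f g).

Definition KHsymm X Y : hom (jn X Y) (jn Y X) := mkcts (@join_symm_cts X Y).

Definition KHassoc X Y Z : hom (jn (jn X Y) Z) (jn X (jn Y Z)) :=
  mkcts (@join_assoc_cts X Y Z).

Lemma test_associ X Y Z :
  test_family (jtest (jtest (cts X) (cts Y)) (cts Z) : set (jn (jn X Y) Z -> R)).
Proof.
by apply: test_KHjoin; [apply: test_KHjoin; exact: test_KH|exact: test_KH].
Qed.

Lemma join_associ_cts X Y Z :
  continuous (@join_associ R X Y Z : jn X (jn Y Z) -> jn (jn X Y) Z).
Proof.
apply: (cts_test (KH_prop (jn (jn X Y) Z)) (@test_associ X Y Z)).
move=> _ [_ [c [[a [b [ca cb ->]]] cc ->]]].
rewrite (_ : _ \o _ = jpair a (jpair b c)).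
  by apply: (@jpair_cts X (jn Y Z)) => //; exact: jpair_cts.
by apply/funext => p; exact: jpair_join_associ.
Qed.

Definition KHassoci X Y Z : hom (jn X (jn Y Z)) (jn (jn X Y) Z) :=
  mkcts (@join_associ_cts X Y Z).

Lemma join_lunit_cts X : continuous (@join_lunit R X : jn KH0 X -> X).
Proof.
apply: (cts_test (KH_prop X) (test_KH X)) => f cf.
rewrite (_ : _ \o _ = jpair (fun=> 0) f).
  by apply: jpair_cts => //; exact: cts_cst.
by apply/funext => -[[]|? []|].
Qed.

Lemma join_runit_cts X : continuous (@join_runit R X : jn X KH0 -> X).
Proof.
apply: (cts_test (KH_prop X) (test_KH X)) => f cf.
rewrite (_ : _ \o _ = jpair f (fun=> 0)).
  by apply: jpair_cts => //; exact: cts_cst.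
by apply/funext => -[|? ? []|[]].
Qed.

Lemma jl_cts X Y : continuous (@jl R X Y : X -> jn X Y).
Proof. exact: jl_continuous. Qed.

Lemma jr_cts X Y : continuous (@jr R X Y : Y -> jn X Y).
Proof. exact: jr_continuous. Qed.

Definition KHinl X Y : hom X (jn X Y) := mkcts (@jl_cts X Y).
Definition KHinr X Y : hom Y (jn X Y) := mkcts (@jr_cts X Y).
Definition KHlunit X : hom (jn KH0 X) X := mkcts (@join_lunit_cts X).
Definition KHrunit X : hom (jn X KH0) X := mkcts (@join_runit_cts X).

(** Axioms without arithmetic in the interval coordinate go by cases, the others by evaluating test
    functions. The definition is transparent because later proofs compute with its fields. *)
Definition join_monoidal : sym_monoidal jn KH0.
Proof.
refine (@SymMonoidal KH jn KH0 KHmap KHassoc KHassoci KHlunit (KHinr KH0) KHrunit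
  (KHinl^~ KH0) KHsymm _ _ _ _ _ _ _ _ _ _ _ _ _ _ _ _).
- by move=> X Y; apply: KH_eq => -[].
- by move=> *; apply: KH_eq => -[].
- move=> X Y Z; apply: (KH_eq_test (@test_associ X Y Z)).
  move=> _ p [_ [c [[a [b [ca cb ->]]] cc ->]]].
  by rewrite /= jpair_join_associ jpair_join_assoc.
- move=> X Y Z; apply: (KH_eq_test (@test_assoc X Y Z)).
  move=> _ p [a [_ [ca [b [c [cb cc ->]]] ->]]].
  by rewrite /= jpair_join_assoc jpair_join_associ.
- by move=> X; apply: KH_eq => -[[]|? []|].
- by move=> X; apply: KH_eq.
- by move=> X; apply: KH_eq => -[|? ? []|[]].
- by move=> X; apply: KH_eq.
- move=> X Y; apply: (KH_eq_test (test_KHjoin (test_KH X) (test_KH Y))).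
  by move=> _ p [a [b [ca cb ->]]]; rewrite /= !jpair_join_symm.
- move=> X X' Y Y' Z Z' f g h; apply: (KH_eq_test (@test_assoc X' Y' Z')).
  move=> _ p [a [_ [ca [b [c [cb cc ->]]] ->]]].
  rewrite /= jpair_join_assoc !jpair_join_map.
  rewrite (_ : jpair b c \o _ = jpair (b \o g) (c \o h)).
    rewrite jpair_join_assoc (_ : jpair a b \o _ = jpair (a \o f) (b \o g))//.
    by apply/funext => q; exact: jpair_join_map.
  by apply/funext => q; exact: jpair_join_map.
- by move=> X X' f; apply: KH_eq => -[[]|? []|].
- by move=> X X' f; apply: KH_eq => -[|? ? []|[]].
- move=> X X' Y Y' f g; apply: (KH_eq_test (test_KHjoin (test_KH Y') (test_KH X'))).
  move=> _ p [a [b [ca cb ->]]].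
  by rewrite /= jpair_join_symm !jpair_join_map jpair_join_symm.
(* Pentagon: both sides pull [a, [b, [c, d]]] back to [[[a, b], c], d]. *)
- move=> X Y Z V.
  apply: (KH_eq_test (test_KHjoin (test_KH X) (@test_assoc Y Z V))).
  move=> _ p [a [_ [ca [b [_ [cb [c [d [cc cd ->]]] ->]]] ->]]].
  rewrite /= !jpair_join_assoc !jpair_join_map.
  rewrite (_ : jpair b _ \o _ = jpair (jpair b c) d); last first.
    by apply/funext => q; exact: jpair_join_assoc.
  rewrite jpair_join_assoc jpair_join_map.
  rewrite (_ : jpair a _ \o _ = jpair (jpair a b) c)//.
  by apply/funext => q; exact: jpair_join_assoc.
(* Triangle: both sides pull [a, b] back to [[a, 0], b], with 0 on the empty space. *)
- move=> X Y; apply: (KH_eq_test (test_KHjoin (test_KH X) (test_KH Y))).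
  move=> _ p [a [b [ca cb ->]]]; rewrite /= !jpair_join_map.
  rewrite (_ : b \o _ = jpair (fun=> 0) b); last first.
    by apply/funext => -[[]|? []|].
  rewrite jpair_join_assoc; congr (jpair _ _ p).
  by apply/funext => -[|? ? []|[]].
(* Hexagon: both sides pull [b, [c, a]] back to [[a, b], c]. *)
- move=> X Y Z; apply: (KH_eq_test (@test_assoc Y Z X)).
  move=> _ p [b [_ [cb [c [a [cc ca ->]]] ->]]].
  rewrite /= jpair_join_assoc jpair_join_symm jpair_join_assoc jpair_join_map.
  rewrite (_ : jpair c a \o _ = jpair a c); last first.
    by apply/funext => q; exact: jpair_join_symm.
  rewrite jpair_join_assoc jpair_join_map; congr (jpair _ _ p).
  by apply/funext => q; rewrite /= jpair_join_symm.
Defined.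

Lemma join_monoidalP : is_join_monoidal join_monoidal.
Proof. by split. Qed.

End JoinMonoidal.

(** * The Radon monad *)

Section RadonMonad.
Variable R : realType.
Implicit Types X Y Z : KH.

Lemma KHradon_prop (X : KHspace) : compact_hausdorff (radon R X).
Proof. by apply: radon_compact_hausdorff; exact: KH_prop. Qed.

Local Notation rn := (KHradon KHradon_prop).

Lemma test_KHradon X : test_family
  [set h : rn X -> R | exists2 f, continuous f & h = rint^~ f].
Proof. by apply: test_radon; exact: KH_prop. Qed.

Lemma KHradon_eq X (v w : rn X) :
  (forall f : X -> R, continuous f -> rint v f = rint w f) -> v = w.
Proof. by apply: rint_inj; exact: KH_prop. Qed.

Lemma KHradon_cts X (Z : topologicalType) (h : Z -> rn X) :
  (forall f : X -> R, continuous f -> continuous (fun z => rint (h z) f)) ->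
  continuous h.
Proof.
move=> ch; apply: (cts_test (KH_prop (rn X)) (test_KHradon X)).
by move=> _ [f cf ->]; exact: ch.
Qed.

Lemma KHrint_cts X (f : X -> R) : continuous f ->
  continuous (fun w : rn X => rint w f).
Proof. by apply: rint_continuous. Qed.

(** The monad operations are given by functionals, which makes the monad laws identities between
    integrals of continuous functions; [radon_monadP] recovers the formulas on Borel sets. *)
Definition kh_map X Y (a : hom X Y) : rn X -> rn Y :=
  radon_map (KH_prop X) (KH_prop Y) (@KH_cts X Y a).

Definition kh_dirac X : X -> rn X := radon_dirac (KH_prop X).

Definition kh_bary X : rn (rn X) -> rn X := @barycenter R X (KH_prop X).

Lemma rint_kh_map X Y (a : hom X Y) (w : rn X) (f : Y -> R) : continuous f ->
  rint (kh_map a w) f = rint w (f \o a).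
Proof. exact: rint_map. Qed.

Lemma rint_kh_dirac X (x : X) (f : X -> R) : continuous f ->
  rint (kh_dirac x) f = f x.
Proof. exact: rint_state_radon. Qed.

Lemma rint_kh_bary X (W : rn (rn X)) (f : X -> R) : continuous f ->
  rint (kh_bary W) f = rint W (fun t => rint t f).
Proof. exact: rint_barycenter. Qed.

Lemma kh_map_cts X Y (a : hom X Y) : continuous (kh_map a).
Proof.
apply: KHradon_cts => f cf; under eq_fun do rewrite rint_kh_map//.
by apply: KHrint_cts; apply: cts_comp => //; exact: KH_cts.
Qed.

Lemma kh_dirac_cts X : continuous (@kh_dirac X).
Proof. by apply: KHradon_cts => f cf; under eq_fun do rewrite rint_kh_dirac//. Qed.

Lemma kh_bary_cts X : continuous (@kh_bary X).
Proof.
apply: KHradon_cts => f cf; under eq_fun do rewrite rint_kh_bary//.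
by apply: (@KHrint_cts (rn X)); exact: KHrint_cts.
Qed.

Definition radon_fmap X Y (a : hom X Y) : hom (rn X) (rn Y) :=
  mkcts (@kh_map_cts X Y a).
Definition radon_eta X : hom X (rn X) := mkcts (@kh_dirac_cts X).
Definition radon_mu X : hom (rn (rn X)) (rn X) := mkcts (@kh_bary_cts X).

Lemma KHradon_hom_eq X (Z : KH) (g h : hom Z (rn X)) :
  (forall (z : Z) (f : X -> R), continuous f -> rint (g z) f = rint (h z) f) ->
  g = h.
Proof. by move=> gh; apply: KH_eq => z; apply: KHradon_eq => f; exact: gh. Qed.

Lemma comp_cts X Y (a : hom X Y) (f : Y -> R) : continuous f -> continuous (f \o a).
Proof. by apply: cts_comp; exact: KH_cts. Qed.

Definition radon_functor : @functor KH KH rn.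
Proof.
refine (@Functor KH KH rn radon_fmap _ _).
- by move=> X; apply: KHradon_hom_eq => w f cf; rewrite rint_kh_map.
- move=> X Y Z g f; apply: KHradon_hom_eq => w h ch.
  by rewrite /= !rint_kh_map//; exact: comp_cts.
Defined.

Definition radon_monad : @monad KH rn.
Proof.
refine (@Monad KH rn radon_functor radon_eta radon_mu _ _ _ _ _).
- move=> X Y a; apply: KHradon_hom_eq => x f cf.
  by rewrite /= rint_kh_map// !rint_kh_dirac//; exact: comp_cts.
- move=> X Y a; apply: KHradon_hom_eq => W f cf.
  have ca := comp_cts (a := a) cf.
  rewrite /= rint_kh_map// !rint_kh_bary// rint_kh_map; last exact: KHrint_cts.
  by congr rint; apply/funext => t; rewrite /= rint_kh_map.
- move=> X; apply: KHradon_hom_eq => w f cf.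
  by rewrite /= rint_kh_bary// rint_kh_dirac//; exact: KHrint_cts.
- move=> X; apply: KHradon_hom_eq => w f cf.
  rewrite /= rint_kh_bary// rint_kh_map; last exact: KHrint_cts.
  by congr rint; apply/funext => t; rewrite /= rint_kh_dirac.
(* Both sides equal the threefold iterated integral of f along V. *)
- move=> X; apply: KHradon_hom_eq => V f cf.
  have cf' := @KHrint_cts X f cf.
  rewrite /= [LHS]rint_kh_bary// [LHS]rint_kh_map// [RHS]rint_kh_bary//.
  rewrite [RHS](@rint_kh_bary (rn X))//.
  by congr rint; apply/funext => t; rewrite /= rint_kh_bary.
Defined.

Lemma radon_monadP : is_radon_monad radon_monad.
Proof.
split.
- by move=> X Y f w B bB; apply: radon_mapE.
- by move=> X x B bB; apply: radon_diracE.
- by move=> X W B bB; apply: barycenterE.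
Qed.

End RadonMonad.

(** * The opmonoidal structure *)

Section Splitting.
Context {R : realType} {X Y : topologicalType}.
Hypotheses (hX : compact_hausdorff X) (hY : compact_hausdorff Y).
Variable w : radon R (join R X Y).
Implicit Types (f : X -> R) (g : Y -> R) (a : R).

Let hJ := join_compact_hausdorff R hX hY.
Let S := rint_state hJ w.

Lemma jpairD (f f' : X -> R) (g g' : Y -> R) p :
  jpair (fun x => f x + f' x) (fun y => g y + g' y) p = jpair f g p + jpair f' g' p.
Proof. by case: p => //= r x y; ring. Qed.

Lemma jpairZ a (f : X -> R) (g : Y -> R) p :
  jpair (fun x => a * f x) (fun y => a * g y) p = a * jpair f g p.
Proof. by case: p => //= r x y; ring. Qed.

Lemma jpair_le (f f' : X -> R) (g g' : Y -> R) p :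
  (forall x, f x <= f' x) -> (forall y, g y <= g' y) ->
  jpair f g p <= jpair f' g' p.
Proof.
move=> ff gg; case: p => //= -[r /= /andP[r0 r1]] x y.
by apply: lerD; apply: ler_wpM2l; rewrite ?subr_ge0// ltW.
Qed.

(** The marginals of w weighted by the interval coordinate: r weights X and 1 - r weights Y. *)
Let wl (f : X -> R) := rint w (jpair f (fun=> 0)).
Let wr (g : Y -> R) := rint w (jpair (fun=> 0) g).

Let wlr f g : continuous f -> continuous g -> rint w (jpair f g) = wl f + wr g.
Proof.
move=> cf cg; rewrite -(stateD S);
  [|by apply: jpair_continuous => //; exact: cts_cst..].
congr rint; apply/funext => p; rewrite -jpairD; congr (jpair _ _ p).
  by apply/funext => x; rewrite addr0.
by apply/funext => y; rewrite add0r.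
Qed.

Let wl_linear a f f' : continuous f -> continuous f' ->
  wl (fun x => a * f x + f' x) = a * wl f + wl f'.
Proof.
have c0 : continuous (fun _ : Y => 0 : R) by exact: cts_cst.
move=> cf cf'; rewrite -(state_linear S); [|exact: jpair_continuous..].
congr rint; apply/funext => p; rewrite -jpairZ -jpairD; congr (jpair _ _ p).
by apply/funext => y; rewrite mulr0 addr0.
Qed.

Let wr_linear a g g' : continuous g -> continuous g' ->
  wr (fun x => a * g x + g' x) = a * wr g + wr g'.
Proof.
have c0 : continuous (fun _ : X => 0 : R) by exact: cts_cst.
move=> cg cg'; rewrite -(state_linear S); [|exact: jpair_continuous..].
congr rint; apply/funext => p; rewrite -jpairZ -jpairD; congr (jpair _ _ p).
by apply/funext => x; rewrite mulr0 addr0.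
Qed.

Let jpair00 p : jpair (fun _ : X => 0) (fun _ : Y => 0) p = 0 :> R.
Proof. exact: jpair_cst. Qed.

Let wl_mono f f' : continuous f -> continuous f' -> (forall x, f x <= f' x) ->
  wl f <= wl f'.
Proof.
have c0 : continuous (fun _ : Y => 0 : R) by exact: cts_cst.
move=> cf cf' ff; apply: (state_le S); [exact: jpair_continuous..|move=> p].
exact: jpair_le.
Qed.

Let wr_mono g g' : continuous g -> continuous g' -> (forall x, g x <= g' x) ->
  wr g <= wr g'.
Proof.
have c0 : continuous (fun _ : X => 0 : R) by exact: cts_cst.
move=> cg cg' gg; apply: (state_le S); [exact: jpair_continuous..|move=> p].
exact: jpair_le.
Qed.

Let c0X : continuous (fun _ : X => 0 : R). Proof. exact: cts_cst. Qed.
Let c0Y : continuous (fun _ : Y => 0 : R). Proof. exact: cts_cst. Qed.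
Let c1X : continuous (fun _ : X => 1 : R). Proof. exact: cts_cst. Qed.
Let c1Y : continuous (fun _ : Y => 1 : R). Proof. exact: cts_cst. Qed.

Let w0 : rint w (jpair (fun=> 0) (fun=> 0)) = 0.
Proof.
rewrite -[RHS](state0 S); congr rint.
by apply/funext => p; rewrite jpair00.
Qed.

Let w1 : wl (fun=> 1) + wr (fun=> 1) = 1.
Proof.
rewrite -wlr// -[RHS](state1 S); congr rint.
by apply/funext => p; rewrite jpair_cst.
Qed.

(** The mass is a separate parameter so that it can be instantiated both by 1 and by [wl (fun=> 1)]
    itself. *)
Let wl_state (a : R) : 0 < a -> wl (fun=> 1) = a -> is_state (fun f => wl f / a).
Proof.
move=> a0 wa; split => [b f g cf cg|f cf f0|].
- by rewrite wl_linear//; ring.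
- rewrite divr_ge0// ?(ltW a0)//; apply: (@le_trans _ _ (wl (fun=> 0))).
    by rewrite /wl w0.
  exact: wl_mono.
- by rewrite wa divff// gt_eqF.
Qed.

Let wr_state (a : R) : 0 < a -> wr (fun=> 1) = a -> is_state (fun g => wr g / a).
Proof.
move=> a0 wa; split => [b f g cf cg|f cf f0|].
- by rewrite wr_linear//; ring.
- rewrite divr_ge0// ?(ltW a0)//; apply: (@le_trans _ _ (wr (fun=> 0))).
    by rewrite /wr w0.
  exact: wr_mono.
- by rewrite wa divff// gt_eqF.
Qed.

(** f lies between the constants -M and M, at which [wl] vanishes together with the mass. *)
Let wl_null f : wl (fun=> 1) = 0 -> continuous f -> wl f = 0.
Proof.
move=> wa cf; have [M M0 fM] := cts_bounded hX cf.
have wc a : wl (fun=> a) = 0.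
  have := wl_linear a c1X c0X; rewrite wa mulr0 addr0 /wl w0.
  by rewrite mulr1 addr0.
apply/eqP; rewrite eq_le -{1}(wc M) -(wc (- M)); apply/andP; split;
  apply: wl_mono => //; [exact: cts_cst| |exact: cts_cst|];
  by move=> x; have := fM x; rewrite ler_norml => /andP[].
Qed.

Let wr_null g : wr (fun=> 1) = 0 -> continuous g -> wr g = 0.
Proof.
move=> wa cf; have [M M0 fM] := cts_bounded hY cf.
have wc a : wr (fun=> a) = 0.
  have := wr_linear a c1Y c0Y; rewrite wa mulr0 addr0 /wr w0.
  by rewrite mulr1 addr0.
apply/eqP; rewrite eq_le -{1}(wc M) -(wc (- M)); apply/andP; split;
  apply: wr_mono => //; [exact: cts_cst| |exact: cts_cst|];
  by move=> x; have := fM x; rewrite ler_norml => /andP[].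
Qed.

(* The point is (r, t, s), where r is the mass of the first coordinate of the
   join and t and s are the normalised weighted marginals. *)
Lemma radon_split : exists p : join R (radon R X) (radon R Y),
  forall f g, continuous f -> continuous g ->
    jpair (rint^~ f) (rint^~ g) p = rint w (jpair f g).
Proof.
have l0 : 0 <= wl (fun=> 1).
  apply: (@le_trans _ _ (wl (fun=> 0))); first by rewrite /wl w0.
  exact: wl_mono.
have r0 : 0 <= wr (fun=> 1).
  apply: (@le_trans _ _ (wr (fun=> 0))); first by rewrite /wr w0.
  exact: wr_mono.
(* A marginal of mass 0 cannot be normalised; the point is then in the opposite end of the join. *)
have [r_0|r_n0] := eqVneq (wr (fun=> 1)) 0.
  have l1 : wl (fun=> 1) = 1 by move: w1; rewrite r_0 addr0.
  exists (jl (state_radon hX (wl_state ltr01 l1))) => f g cf cg /=.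
  by rewrite rint_state_radon// wlr// wr_null// addr0 divr1.
have [l_0|l_n0] := eqVneq (wl (fun=> 1)) 0.
  have r1 : wr (fun=> 1) = 1 by move: w1; rewrite l_0 add0r.
  exists (jr (state_radon hY (wr_state ltr01 r1))) => f g cf cg /=.
  by rewrite rint_state_radon// wlr// wl_null// add0r divr1.
have lp : 0 < wl (fun=> 1) by rewrite lt_def l_n0.
have rp : 0 < wr (fun=> 1) by rewrite lt_def r_n0.
have l01 : 0 < wl (fun=> 1) < 1 by rewrite lp/= -[X in _ < X]w1 ltrDl.
pose r : oitv R := exist (fun r => 0 < r < 1) (wl (fun=> 1)) l01.
exists (jm r (state_radon hX (wl_state lp erefl))
  (state_radon hY (wr_state rp erefl))) => f g cf cg /=.
rewrite !rint_state_radon// wlr// -[X in X - _]w1 addrAC subrr add0r.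
by rewrite ![_ * (_ / _)]mulrC !mulfVK.
Qed.

End Splitting.

Section RadonOpmonoidal.
Variable R : realType.
Implicit Types X Y Z : KH.
Local Notation jn := (KHjoin (@KHjoin_prop R)).
Local Notation rn := (KHradon (@KHradon_prop R)).
Local Notation J := (join_monoidal R).
Local Notation M := (radon_monad R).

(** The chosen point is the only one with its property, as the functions [int f, int g] separate
    points. *)
Definition kh_split X Y (w : rn (jn X Y)) : jn (rn X) (rn Y) :=
  projT1 (cid (radon_split (KH_prop X) (KH_prop Y) w)).

Lemma jpair_kh_split X Y (w : rn (jn X Y)) (f : X -> R) (g : Y -> R) :
  continuous f -> continuous g ->
  jpair (rint^~ f) (rint^~ g) (kh_split w) = rint w (jpair f g).
Proof. by rewrite /kh_split; case: cid => p /= pP; exact: pP. Qed.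

Lemma test_KHjoin_radon X Y : test_family (jtest
  [set h : rn X -> R | exists2 f, continuous f & h = rint^~ f]
  [set h : rn Y -> R | exists2 f, continuous f & h = rint^~ f] :
  set (jn (rn X) (rn Y) -> R)).
Proof. by apply: test_KHjoin; exact: test_KHradon. Qed.

Lemma test_KHjoin_radon3 X Y Z : test_family (jtest
  [set h : rn X -> R | exists2 f, continuous f & h = rint^~ f]
  (jtest [set h : rn Y -> R | exists2 f, continuous f & h = rint^~ f]
    [set h : rn Z -> R | exists2 f, continuous f & h = rint^~ f]) :
  set (jn (rn X) (jn (rn Y) (rn Z)) -> R)).
Proof.
apply: (@test_KHjoin R (rn X) (jn (rn Y) (rn Z))); first exact: test_KHradon.
exact: test_KHjoin_radon.
Qed.

Lemma kh_split_cts X Y : continuous (@kh_split X Y).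
Proof.
apply: (cts_test (KH_prop (jn (rn X) (rn Y))) (@test_KHjoin_radon X Y)).
move=> _ [_ [_ [[f cf ->] [g cg ->] ->]]].
rewrite (_ : _ \o _ = rint^~ (jpair f g)).
  by apply: (@KHrint_cts R (jn X Y)); exact: jpair_cts.
by apply/funext => w; exact: jpair_kh_split.
Qed.

Definition radon_ups X Y : hom (rn (jn X Y)) (jn (rn X) (rn Y)) :=
  mkcts (@kh_split_cts X Y).

(** A probability measure comes with a point of its space, so the empty space carries none. *)
Definition kh_void (w : rn KH0) : KH0 := radon_point w.

Lemma kh_void_cts : continuous kh_void.
Proof. by move=> w; case: (kh_void w). Qed.

Definition radon_ups0 : hom (rn KH0) KH0 := mkcts kh_void_cts.

Lemma KHjoin_radon_eq X Y Z (g h : hom Z (jn (rn X) (rn Y))) :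
  (forall (z : Z) (a : X -> R) (b : Y -> R), continuous a -> continuous b ->
    jpair (rint^~ a) (rint^~ b) (g z) = jpair (rint^~ a) (rint^~ b) (h z)) ->
  g = h.
Proof.
move=> gh; apply: (KH_eq_test (@test_KHjoin_radon X Y)).
by move=> _ z [_ [_ [[a ca ->] [b cb ->] ->]]]; exact: gh.
Qed.

Lemma rn0_absurd (P : Type) : rn KH0 -> P.
Proof. by move=> w; case: (kh_void w). Qed.

Definition radon_opmonoidal : sym_opmonoidal J M.
Proof.
refine (@SymOpmonoidal KH jn KH0 J rn M radon_ups0 radon_ups _ _ _ _ _ _ _ _ _).
- move=> X X' Y Y' f g; apply: KHjoin_radon_eq => w a b ca cb.
  rewrite /= jpair_join_map jpair_kh_split// rint_kh_map; last exact: jpair_cts.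
  rewrite (_ : rint^~ a \o _ = rint^~ (a \o f)); last first.
    by apply/funext => v; exact: rint_kh_map.
  rewrite (_ : rint^~ b \o _ = rint^~ (b \o g)); last first.
    by apply/funext => v; exact: rint_kh_map.
  rewrite jpair_kh_split; [|exact: comp_cts..].
  by congr rint; apply/funext => p; rewrite /= jpair_join_map.
(* Both sides take [int a, [int b, int c]] to the integral of [[a, b], c] against w. *)
- move=> X Y Z; apply: (KH_eq_test (@test_KHjoin_radon3 X Y Z)).
  move=> _ w [_ [_ [[a ca ->] [_ [_ [[b cb ->] [c cc ->] ->]]] ->]]].
  rewrite /= jpair_join_assoc !jpair_join_map.
  rewrite (_ : jpair (rint^~ a) (rint^~ b) \o _ = rint^~ (jpair a b)); last first.
    by apply/funext => v; exact: jpair_kh_split.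
  rewrite (_ : jpair (rint^~ b) (rint^~ c) \o _ = rint^~ (jpair b c)); last first.
    by apply/funext => v; exact: jpair_kh_split.
  have cab : continuous (jpair a b : jn X Y -> R) by exact: jpair_cts.
  have cbc : continuous (jpair b c : jn Y Z -> R) by exact: jpair_cts.
  rewrite (@jpair_kh_split (jn X Y) Z)// (@jpair_kh_split X (jn Y Z))//.
  rewrite rint_kh_map; last exact: (@jpair_cts _ X (jn Y Z)).
  by congr rint; apply/funext => p; rewrite /= jpair_join_assoc.
- move=> X; apply: KHradon_hom_eq => w f cf.
  have c0 : continuous (fun _ : KH0 => 0 : R) by exact: cts_cst.
  rewrite /= rint_kh_map// -[LHS]/((rint^~ f \o join_lunit (X := rn X)) _).
  rewrite (_ : _ \o _ = jpair (fun=> 0) (rint^~ f)); last first.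
    by apply/funext => -[[]|? []|].
  (* There are no measures on the empty space, so the zero function may be read as an integral
     there, as [jpair_kh_split] requires. *)
  rewrite jpair_join_map (_ : _ \o _ = rint^~ (fun=> 0)); last first.
    by apply/funext => v; exact: rn0_absurd.
  transitivity (rint w (jpair (fun=> 0) f)); first exact: jpair_kh_split.
  by congr rint; apply/funext => -[[]|? []|].
- move=> X; apply: KHradon_hom_eq => w f cf.
  have c0 : continuous (fun _ : KH0 => 0 : R) by exact: cts_cst.
  rewrite /= rint_kh_map// -[LHS]/((rint^~ f \o join_runit (X := rn X)) _).
  rewrite (_ : _ \o _ = jpair (rint^~ f) (fun=> 0)); last first.
    by apply/funext => -[|? ? []|[]].
  rewrite jpair_join_map (_ : (fun=> 0) \o _ = rint^~ (fun=> 0)); last first.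
    by apply/funext => v; exact: rn0_absurd.
  transitivity (rint w (jpair f (fun=> 0))); first exact: jpair_kh_split.
  by congr rint; apply/funext => -[|? ? []|[]].
- move=> X Y; apply: KHjoin_radon_eq => w a b ca cb.
  rewrite /= jpair_join_symm !jpair_kh_split// rint_kh_map; last exact: jpair_cts.
  by congr rint; apply/funext => p; rewrite /= jpair_join_symm.
- move=> X Y; apply: KHjoin_radon_eq => p a b ca cb.
  rewrite /= jpair_kh_split// rint_kh_dirac; last exact: jpair_cts.
  rewrite jpair_join_map; congr (jpair _ _ p).
    by apply/funext => x; rewrite /= rint_kh_dirac.
  by apply/funext => y; rewrite /= rint_kh_dirac.
- exact: KH_eq.
(* Both sides take [int a, int b] to the iterated integral of [a, b] along W. *)
- move=> X Y; apply: KHjoin_radon_eq => W a b ca cb.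
  rewrite /= jpair_kh_split// rint_kh_bary; last exact: jpair_cts.
  rewrite jpair_join_map.
  rewrite (_ : rint^~ a \o _ = rint^~ (rint^~ a)); last first.
    by apply/funext => v; exact: rint_kh_bary.
  rewrite (_ : rint^~ b \o _ = rint^~ (rint^~ b)); last first.
    by apply/funext => v; exact: rint_kh_bary.
  have cra := KHrint_cts ca; have crb := KHrint_cts cb.
  rewrite (@jpair_kh_split (rn X) (rn Y))// rint_kh_map; last first.
    exact: (@jpair_cts _ (rn X) (rn Y)).
  by congr rint; apply/funext => v; rewrite /= jpair_kh_split.
- by apply: KH_eq => W; exact: (rn0_absurd _ (radon_point W)).
Defined.

End RadonOpmonoidal.

(** * Coproducts of algebras *)

Section LinearExponential.
Variable R : realType.
Implicit Types X Y Z : KH.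
Local Notation jn := (KHjoin (@KHjoin_prop R)).
Local Notation rn := (KHradon (@KHradon_prop R)).
Local Notation J := (join_monoidal R).
Local Notation M := (radon_monad R).
Local Notation U := (radon_opmonoidal R).

Lemma fork_state X Y Z (a : X -> Z) (b : Y -> Z) (p : join R X Y) :
  is_state (fun f : Z -> R => jpair (f \o a) (f \o b) p).
Proof.
split => [c f g cf cg|f cf f0|].
- by rewrite -jpairZ -jpairD.
- case: p => [x|[r /= /andP[r0 r1]] x y|y] /=; [exact: f0| |exact: f0].
  by rewrite addr_ge0// mulr_ge0// ?subr_ge0// ltW.
- exact: jpair_cst.
Qed.

(* The measure r d_(a x) + (1 - r) d_(b y) at the point (r, x, y). *)
Definition kh_fork X Y Z (a : hom X Z) (b : hom Y Z) (p : jn X Y) : rn Z :=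
  state_radon (KH_prop Z) (fork_state a b p).

Lemma rint_kh_fork X Y Z (a : hom X Z) (b : hom Y Z) (p : jn X Y) (f : Z -> R) :
  continuous f -> rint (kh_fork a b p) f = jpair (f \o a) (f \o b) p.
Proof. exact: rint_state_radon. Qed.

Lemma kh_fork_cts X Y Z (a : hom X Z) (b : hom Y Z) : continuous (kh_fork a b).
Proof.
apply: KHradon_cts => f cf; under eq_fun do rewrite rint_kh_fork//.
by apply: jpair_cts; exact: comp_cts.
Qed.

Definition radon_fork X Y Z (a : hom X Z) (b : hom Y Z) : hom (jn X Y) (rn Z) :=
  mkcts (@kh_fork_cts X Y Z a b).

Lemma fork_map X X' Y Y' Z (a : hom X' Z) (b : hom Y' Z) (a' : hom X X')
    (b' : hom Y Y') p :
  kh_fork a b (join_map a' b' p) = kh_fork (a ∘ a') (b ∘ b') p.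
Proof.
by apply: KHradon_eq => f cf; rewrite !rint_kh_fork// jpair_join_map.
Qed.

Lemma map_fork X Y Z V (a : hom X Z) (b : hom Y Z) (c : hom Z V) p :
  kh_map c (kh_fork a b p) = kh_fork (c ∘ a) (c ∘ b) p.
Proof.
apply: KHradon_eq => f cf.
by rewrite rint_kh_map// !rint_kh_fork//; exact: comp_cts.
Qed.

(** At a test function f both sides integrate [f o a, f o b] against w. This is what makes the
    cotuple an algebra map. *)
Lemma bary_fork_split X Y Z (a : hom X Z) (b : hom Y Z) (w : rn (jn X Y)) :
  kh_bary (kh_fork (radon_fmap R a) (radon_fmap R b) (kh_split w)) =
  kh_bary (kh_map (radon_fork a b) w).
Proof.
apply: KHradon_eq => f cf; have cr := KHrint_cts cf.
rewrite !rint_kh_bary// rint_kh_fork// rint_kh_map//.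
rewrite (_ : _ \o radon_fmap R a = rint^~ (f \o a)); last first.
  by apply/funext => v; exact: rint_kh_map.
rewrite (_ : _ \o radon_fmap R b = rint^~ (f \o b)); last first.
  by apply/funext => v; exact: rint_kh_map.
rewrite jpair_kh_split; [|exact: comp_cts..].
by congr rint; apply/funext => p; rewrite /= rint_kh_fork.
Qed.

(** Together with the unit laws this shows that every point of a tensor of algebras is the value of
    the structure map at a measure carried by the two ends, which forces uniqueness of the
    cotuple. *)
Lemma split_fork X Y (p : jn X Y) :
  kh_split (kh_fork (KHinl R X Y) (KHinr R X Y) p) =
  join_map (@kh_dirac R X) (@kh_dirac R Y) p.
Proof.
apply: (test_separate (@test_KHjoin_radon R X Y)).
move=> _ [_ [_ [[a ca ->] [b cb ->] ->]]].
rewrite jpair_kh_split// rint_kh_fork; last exact: jpair_cts.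
rewrite jpair_join_map; congr (jpair _ _ p).
  by apply/funext => x; rewrite /= rint_kh_dirac.
by apply/funext => y; rewrite /= rint_kh_dirac.
Qed.

Lemma KH_app X Y (a b : hom X Y) (x : X) : a = b -> a x = b x.
Proof. by move=> ->. Qed.

Section Cotuple.
Variables (X Y Z : EM M) (f : @hom (EM M) X Z) (g : @hom (EM M) Y Z).

Let alg_app (A B : EM M) (k : @hom (EM M) A B) (w : rn (carrier A)) :
  sval k (act A w) = act B (kh_map (sval k) w).
Proof. exact: (KH_app w (svalP k)). Qed.

Let act_bary (A : EM M) (V : rn (rn (carrier A))) :
  act A (kh_bary V) = act A (kh_map (act A) V).
Proof. exact: (KH_app V (act_mu A)). Qed.

Let act_dirac (A : EM M) (x : carrier A) : act A (kh_dirac R x) = x.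
Proof. exact: (KH_app x (act_eta A)). Qed.

Definition cotuple_hom : hom (jn (carrier X) (carrier Y)) (carrier Z) :=
  act Z ∘ radon_fork (sval f) (sval g).

Lemma cotuple_subproof :
  cotuple_hom ∘ act (tens_alg U X Y) = act Z ∘ Defs.fmap M cotuple_hom.
Proof.
apply: KH_eq => w.
rewrite -[LHS]/(act Z (kh_fork (sval f) (sval g)
  (join_map (act X) (act Y) (kh_split w)))).
rewrite -[RHS]/(act Z (kh_map cotuple_hom w)).
(* Since f and g are algebra maps, the structure map of Z moves out of the fork; its compatibility
   with the multiplication then reduces the claim to [bary_fork_split]. *)
rewrite fork_map (svalP f) (svalP g) -map_fork -act_bary bary_fork_split act_bary.
congr (act Z _); apply: KHradon_eq => h ch.
have cz : continuous (h \o act Z) by exact: comp_cts.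
by rewrite !rint_kh_map.
Qed.

Definition cotuple : @hom (EM M) (tens_alg U X Y) Z :=
  exist _ cotuple_hom cotuple_subproof.

(** At an end of the join the fork is a point mass, which the unit law of Z evaluates. *)
Lemma cotuple_inl (x : carrier X) : sval cotuple (jl x) = sval f x.
Proof.
rewrite /= -[LHS]/(act Z (kh_fork (sval f) (sval g) (jl x))).
rewrite -[RHS]act_dirac; congr (act Z _); apply: KHradon_eq => h ch.
by rewrite rint_kh_fork// rint_kh_dirac.
Qed.

Lemma cotuple_inr (y : carrier Y) : sval cotuple (jr y) = sval g y.
Proof.
rewrite /= -[LHS]/(act Z (kh_fork (sval f) (sval g) (jr y))).
rewrite -[RHS]act_dirac; congr (act Z _); apply: KHradon_eq => h ch.
by rewrite rint_kh_fork// rint_kh_dirac.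
Qed.

Lemma cotuple_unique (k : @hom (EM M) (tens_alg U X Y) Z) :
  (forall x, sval k (jl x) = sval f x) -> (forall y, sval k (jr y) = sval g y) ->
  k = cotuple.
Proof.
move=> kl kr; apply: alg_hom_eq; apply: KH_eq => p.
(* The measure r d_x + (1 - r) d_y on the two ends, where k is prescribed; the structure map sends
   it to p. *)
pose w : rn (jn (carrier X) (carrier Y)) := kh_fork (KHinl R _ _) (KHinr R _ _) p.
have pE : p = act (tens_alg U X Y) w.
  rewrite -[RHS]/(join_map (act X) (act Y) (kh_split w)) split_fork.
  by case: p {w} => [x|r x y|y] /=; rewrite !act_dirac.
rewrite {1}pE alg_app map_fork -[RHS]/(act Z (kh_fork (sval f) (sval g) p)).
by congr (act Z (kh_fork _ _ p)); apply: KH_eq.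
Qed.

End Cotuple.

Lemma radon_linear_exponential : linear_exponential U.
Proof.
split.
  move=> A; pose u0 : KH0 -> carrier A := fun v : void => match v with end.
  have cu : continuous u0 by case.
  pose u : hom KH0 (carrier A) := mkcts cu.
  have uP : u ∘ act (unit_alg U) = act A ∘ Defs.fmap M u.
    by apply: KH_eq => w; exact: rn0_absurd w.
  exists (exist _ u uP) => v; apply: alg_hom_eq; apply: KH_eq => -[].
move=> X Y bX bY Z f g; exists (cotuple f g); split.
  (* The legs of the cospan compute to [jl] and [jr], whatever the maps [bX] and [bY]. *)
  split; apply: alg_hom_eq; apply: KH_eq => x.
    exact: (cotuple_inl f g x).
  exact: (cotuple_inr f g x).
move=> k [kl kr]; apply: cotuple_unique => x.
  exact: (KH_app x (congr1 (@proj1_sig _ _) kl)).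
exact: (KH_app x (congr1 (@proj1_sig _ _) kr)).
Qed.

End LinearExponential.

Theorem proposition37 (R : realType) :
  exists (hJ : forall X Y : KHspace, compact_hausdorff (join R X Y))
         (hR : forall X : KHspace, compact_hausdorff (radon R X))
         (J : sym_monoidal (KHjoin hJ) KH0)
         (M : monad (KHradon hR)),
    [/\ is_join_monoidal J, is_radon_monad M &
        exists U : sym_opmonoidal J M, linear_exponential U].
Proof.
exists (@KHjoin_prop R), (@KHradon_prop R), (join_monoidal R), (radon_monad R).
split; [exact: join_monoidalP|exact: radon_monadP|].
by exists (radon_opmonoidal R); exact: radon_linear_exponential.
Qed.
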